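(* Let $X \in \mathbb{R}^{n \times d}$ and $\alpha > 0$. Let $q \in \mathbb{N}$ be even and $1 \le p \le q$. Let $\gamma_p = 1/p - 1/2$ when $p \le 2$ and $\gamma_p = 1/2 - 1/p$ when $p \ge 2$. There exists an algorithm running in time $O(n^2 d^2 + n d^3)$ that, given $X$, outputs a list $L$ containing $O(n+d)$ nonzero vectors in $\mathbb{R}^d$ such that \[ \|X\|_{p\to q} \le d^{\gamma_p + 1/4 - 1/(2q)} \cdot \max_{\hat v \in L} \frac{\|X\hat v\|_q}{\|\hat v\|_p} \le d^{\gamma_p + 1/4 - 1/(2q)} \cdot \|X\|_{p\to q}. \] Consequently, by computing $\|X\hat v\|_q$ for all $\hat v\in L$, in the same time one can: (1) certify that $\|X\|_{p\to q} \le \alpha\cdot d^{\gamma_p + 1/4 - 1/(2q)}$ whenever $\|X\|_{p\to q}\le\alpha$; that is, output a number $\mathrm{ALG}(X)$ with $\|X\|_{p\to q}\le \mathrm{ALG}(X)$ for every $X$ and $\mathrm{ALG}(X)\le \alpha\cdot d^{\gamma_p + 1/4 - 1/(2q)}$ whenever $\|X\|_{p\to q}\le\alpha$; (2) compute a vector $\hat v$ with $\|\hat v\|_p = 1$ and $\|X\hat v\|_q \ge \|X\|_{p\to q}/d^{\gamma_p + 1/4 - 1/(2q)}$.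
   Context: Here $\|\cdot\|_p$, $\|\cdot\|_q$ are the standard (unnormalized) $\ell_p$, $\ell_q$ norms, and for $X\in\mathbb R^{n\times d}$, $\|X\|_{p\to q} = \sup_{v\in\mathbb R^d,\ \|v\|_p = 1}\|Xv\|_q$. Running time is measured in arithmetic operations.
   Formalization: Running time is counted on a real machine where an exact eigendecomposition of a symmetric m×m matrix costs m^3 and a real power costs 1; with plain arithmetic operations alone the claim fails for p=q=2, where L must contain an exact top singular vector. Also n,d≥1 is assumed. *)

(* Defs.v *)
From HB Require Import structures.
From mathcomp Require Import all_boot all_order all_algebra.
From mathcomp Require Import all_classical all_reals all_analysis.
From mathcomp Require complex.

Set Implicit Arguments.
Unset Strict Implicit.
Unset Printing Implicit Defensive.

Import Order.TTheory GRing.Theory Num.Theory.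

Local Open Scope classical_set_scope.
Local Open Scope ring_scope.

Section Norms.
Variable R : realType.

Definition lpnorm (p : R) (k : nat) (v : 'cV[R]_k) : R :=
  (\sum_(i < k) `|v i 0| `^ p) `^ p^-1.

Definition opnorm (p q : R) (n d : nat) (X : 'M[R]_(n, d)) : R :=
  sup [set lpnorm q (X *m v) | v in [set v : 'cV[R]_d | lpnorm p v = 1]].

Definition gamma_exp (p : R) : R :=
  if p <= 2 then p^-1 - 2^-1 else 2^-1 - p^-1.

Definition approx_factor (p : R) (q d : nat) : R :=
  d%:R `^ (gamma_exp p + 4^-1 - (2 * q%:R)^-1).

(* The ratios are nonnegative, so for a nonempty list the default value 0 does
   not affect the maximum. *)
Definition max_ratio (p : R) (q : nat) (n d : nat) (X : 'M[R]_(n, d))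
    (L : seq 'cV[R]_d) : R :=
  \big[Num.max/0]_(v <- L) (lpnorm q%:R (X *m v) / lpnorm p v).

End Norms.

(* Model of computation: a real random access machine, programmed in a
   structured language.  A program is a finite syntactic object that does not
   depend on the size of its input.  The memory consists of integer registers
   and of two-dimensional real arrays of unbounded size; real numbers cannot be
   converted to integers.  Every node of an evaluated expression (constant,
   memory access, arithmetic operation), every executed command and every loop
   iteration costs one unit. *)
Section Machine.
Variable R : realType.

Inductive iexp : Type :=
| IConst of nat
| IVar of nat
| IAdd of iexp & iexp.

(* The exponent of [RPow] is a constant of the program; the operation is only
   meaningful on nonnegative arguments, [powR] being 1 on negative ones. *)
Inductive rexp : Type :=
| RConst of R
| RNat of iexp
| RGet of nat & iexp & iexp
| RAdd of rexp & rexp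
| RSub of rexp & rexp
| RMul of rexp & rexp
| RDiv of rexp & rexp
| RPow of rexp & R.

(* [CEig a e b c] reads the e x e matrix stored in array a, and writes an
   orthonormal eigenbasis (in columns) to array b and the corresponding
   eigenvalues to row 0 of array c. *)
Inductive cmd : Type :=
| CSkip
| CSeq of cmd & cmd
| CISet of nat & iexp
| CRSet of nat & iexp & iexp & rexp
| CIfLe of rexp & rexp & cmd & cmd
| CFor of nat & iexp & cmd
| CEig of nat & iexp & nat & nat.

Record state := State {
  ireg : nat -> nat;
  rmem : nat -> nat -> nat -> R }.

Definition set_ireg (x m : nat) (s : state) : state :=
  State (fun y => if y == x then m else ireg s y) (rmem s).

Definition set_array (a : nat) (A : nat -> nat -> R) (s : state) : state :=
  State (ireg s) (fun b => if b == a then A else rmem s b).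

Definition set_cell (a i j : nat) (r : R) (s : state) : state :=
  set_array a
    (fun k l => if (k == i) && (l == j) then r else rmem s a k l) s.

Definition put_mx (m k : nat) (M : 'M[R]_(m, k)) (A : nat -> nat -> R) :
    nat -> nat -> R :=
  fun i j => match insub i, insub j with
             | Some i', Some j' => M i' j'
             | _, _ => A i j
             end.

Fixpoint ieval (s : state) (e : iexp) : nat :=
  match e with
  | IConst m => m
  | IVar x => ireg s x
  | IAdd e1 e2 => (ieval s e1 + ieval s e2)%N
  end.

Fixpoint reval (s : state) (e : rexp) : R :=
  match e with
  | RConst r => r
  | RNat e1 => (ieval s e1)%:R
  | RGet a e1 e2 => rmem s a (ieval s e1) (ieval s e2)
  | RAdd e1 e2 => reval s e1 + reval s e2
  | RSub e1 e2 => reval s e1 - reval s e2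
  | RMul e1 e2 => reval s e1 * reval s e2
  | RDiv e1 e2 => reval s e1 / reval s e2
  | RPow e1 r => reval s e1 `^ r
  end.

Fixpoint icost (e : iexp) : nat :=
  match e with
  | IConst _ | IVar _ => 1
  | IAdd e1 e2 => (icost e1 + icost e2).+1
  end.

Fixpoint rcost (e : rexp) : nat :=
  match e with
  | RConst _ => 1
  | RNat e1 => (icost e1).+1
  | RGet _ e1 e2 => (icost e1 + icost e2).+1
  | RAdd e1 e2 | RSub e1 e2 | RMul e1 e2 | RDiv e1 e2 =>
      (rcost e1 + rcost e2).+1
  | RPow e1 _ => (rcost e1).+1
  end.

Definition eig_fun := forall m : nat, 'M[R]_m -> 'M[R]_m * 'rV[R]_m.

(* Nothing is assumed on the output for non-symmetric matrices, nor on the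
   choice of the basis or on the order of the eigenvalues. *)
Definition eigensolver (eig : eig_fun) : Prop :=
  forall (m : nat) (A : 'M[R]_m), A^T = A ->
    (eig m A).1^T *m (eig m A).1 = 1%:M /\
    A *m (eig m A).1 = (eig m A).1 *m diag_mx (eig m A).2.

Definition exec_eig (eig : eig_fun) (a m b c : nat) (s : state) : state :=
  let Ul := eig m (\matrix_(i < m, j < m) rmem s a i j) in
  let s' := set_array b (put_mx Ul.1 (rmem s b)) s in
  set_array c (put_mx Ul.2 (rmem s' c)) s'.

Fixpoint exec (eig : eig_fun) (c : cmd) (s : state) : state :=
  match c with
  | CSkip => s
  | CSeq c1 c2 => exec eig c2 (exec eig c1 s)
  | CISet x e => set_ireg x (ieval s e) s
  | CRSet a e1 e2 e => set_cell a (ieval s e1) (ieval s e2) (reval s e) s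
  | CIfLe e1 e2 c1 c2 =>
      if reval s e1 <= reval s e2 then exec eig c1 s else exec eig c2 s
  | CFor x e c1 =>
      iteri (ieval s e) (fun k s' => exec eig c1 (set_ireg x k s')) s
  | CEig a e b b' => exec_eig eig a (ieval s e) b b' s
  end.

(* The eigendecomposition of a symmetric m x m matrix is charged m ^ 3. *)
Fixpoint time (eig : eig_fun) (c : cmd) (s : state) : nat :=
  match c with
  | CSkip => 1
  | CSeq c1 c2 => (time eig c1 s + time eig c2 (exec eig c1 s)).+1
  | CISet _ e => (icost e).+1
  | CRSet _ e1 e2 e => (icost e1 + icost e2 + rcost e).+1
  | CIfLe e1 e2 c1 c2 =>
      (rcost e1 + rcost e2 +
       (if (reval s e1 <= reval s e2)%R then time eig c1 s
        else time eig c2 s)).+1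
  | CFor x e c1 =>
      (icost e + \sum_(k < ieval s e)
        (time eig c1 (set_ireg x k
           (iteri k (fun l s' => exec eig c1 (set_ireg x l s')) s))).+1).+1
  | CEig _ e _ _ => (icost e + ieval s e ^ 3).+1
  end%N.

(* Input: the dimensions in integer registers 0 and 1, the matrix in array 0;
   the rest of the memory is zero. *)
Definition init_state (n d : nat) (X : 'M[R]_(n, d)) : state :=
  State (fun x => nth 0%N [:: n; d] x)
        (fun a => if a == 0%N then put_mx X (fun _ _ => 0) else fun _ _ => 0).

(* Output conventions: a list of vectors has its length in integer register 2
   and its elements in the rows of array 1; a number is in cell (0, 0) of array
   2; a vector is in row 0 of array 3. *)
Definition out_list (d : nat) (s : state) : seq 'cV[R]_d :=
  [seq \col_(j < d) rmem s 1 k j | k <- iota 0 (ireg s 2)].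

Definition out_num (s : state) : R := rmem s 2 0 0.

Definition out_vec (d : nat) (s : state) : 'cV[R]_d :=
  \col_(j < d) rmem s 3 0 j.

End Machine.

(* The specification [eigensolver] is satisfiable: this is the spectral theorem
   for real symmetric matrices, proved by deflation along an eigenvector with a
   Householder reflection. *)
Section Spectral.
Import complex.
Local Open Scope sesquilinear_scope.
Variable R : rcfType.

Lemma sym_eigen (m : nat) (A : 'M[R]_m.+1) : A^T = A -> exists a, eigenvalue A a.
Proof.
move=> As; pose f := real_complex R.
have [//|mu] := @eigenvalue_closed _ m.+1 (map_mx f A).
have fA : (map_mx f A) ^t* = map_mx f A.
  apply/matrixP=> i j; rewrite !mxE -{1}As mxE conj_Creal//.
  by apply/complex_realP; exists (A i j).
move=> emu; have /eigenvalueP [v vA v0] := emu.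
have vv0 : (v *m v ^t*) 0 0 != 0.
  by rewrite -dotmxE dnorm_eq0.
have : mu * (v *m v ^t*) 0 0 \is Num.real.
  rewrite -[_ * _](_ : (v *m map_mx f A *m v ^t*) 0 0 = _); last first.
    by rewrite vA -scalemxAl mxE.
  rewrite CrealE; apply/eqP.
  set M := v *m _ *m _.
  have -> : (M 0 0)^* = (M ^t*) 0 0 by rewrite !mxE.
  congr (fun_of_matrix _ 0 0); rewrite /M !trmx_mul !map_mxM /= -mulmxA.
  by rewrite fA [X in X *m _]trmxCK.
rewrite mulrC realMr//; last by rewrite -dotmxE ger0_real// dnorm_ge0.
move=> /complex_realP [a mua]; exists a; move: emu.
by rewrite mua !eigenvalue_root_char -map_char_poly fmorph_root.
Qed.

Lemma rv_dot_gt0 (m : nat) (u : 'rV[R]_m) : u != 0 -> 0 < (u *m u^T) 0 0.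
Proof.
move=> u0; rewrite mxE lt_def; apply/andP; split; last first.
  by apply: sumr_ge0 => i _; rewrite mxE -expr2 sqr_ge0.
apply: contra u0 => /eqP h; apply/eqP/rowP => i; rewrite mxE.
have /psumr_eq0P : forall j : 'I_m, true -> 0 <= u 0 j * u^T j 0.
  by move=> j _; rewrite mxE -expr2 sqr_ge0.
by move=> /(_ h i isT)/eqP; rewrite mxE -expr2 sqrf_eq0 => /eqP.
Qed.

Lemma householder (m : nat) (e w : 'rV[R]_m) :
  e *m e^T = 1%:M -> w *m w^T = 1%:M ->
  exists H : 'M[R]_m, [/\ H^T = H, H *m H = 1%:M & e *m H = w].
Proof.
move=> ee ww; have [->|ne] := eqVneq w e.
  by exists 1%:M; rewrite trmx1 mulmx1 mulmx1.
pose u := w - e; have u0 : 0 < (u *m u^T) 0 0 by rewrite rv_dot_gt0// subr_eq0.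
set c := (u *m u^T) 0 0 in u0.
have uu : u *m u^T = c%:M by rewrite [LHS]mx11_scalar.
have we : w *m e^T = e *m w^T.
  rewrite [LHS]mx11_scalar [RHS]mx11_scalar; congr (_ %:M).
  by rewrite !mxE; apply: eq_bigr => i _; rewrite !mxE mulrC.
have E2 : 2%:M = 1%:M *+ 2 :> 'M[R]_1 by rewrite -scalemx1 scaler_nat.
have cE : c%:M = 2%:M - (e *m w^T) *+ 2 :> 'M[R]_1.
  rewrite -uu /u linearB /= mulmxBl !mulmxBr ee ww we.
  set x := e *m w^T.
  by rewrite E2 opprB -mulrnBl mulr2n.
have eu : (e *m u^T) *+ 2 = - c%:M.
  by rewrite cE /u linearB /= mulmxBr ee mulrnBl opprB E2.
exists (1%:M - (2 / c) *: (u^T *m u)); split.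
- by rewrite linearB /= linearZ /= trmx_mul trmxK trmx1.
- set P := u^T *m u.
  have PP : P *m P = c *: P.
    by rewrite /P mulmxA -(mulmxA u^T) uu mul_mx_scalar -scalemxAl.
  rewrite mulmxBl mul1mx mulmxBr mulmx1 -scalemxAl -scalemxAr PP !scalerA.
  have -> : 2 / c * (2 / c) * c = 2 / c + 2 / c.
    by rewrite -mulrA divfK ?gt_eqF// mulr_natr mulr2n.
  by rewrite scalerDl opprB addrK addrNK.
- rewrite mulmxBr mulmx1 -scalemxAr mulmxA.
  have -> : (2 / c) *: (e *m u^T *m u) = c^-1 *: ((e *m u^T *+ 2) *m u).
    by rewrite mulrC -scalerA scaler_nat !mulr2n mulmxDl.
  rewrite eu mulNmx mul_scalar_mx scalerN scalerA mulVf ?gt_eqF// scale1r opprK.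
  by rewrite /u addrC subrK.
Qed.

Lemma real_spectral (m : nat) (A : 'M[R]_m) : A^T = A ->
  exists U : 'M[R]_m * 'rV[R]_m,
    U.1^T *m U.1 = 1%:M /\ A *m U.1 = U.1 *m diag_mx U.2.
Proof.
elim: m A => [|m IH] A As.
  by exists (1%:M, 0); split; apply/matrixP=> -[].
have [a /eigenvalueP [w0 w0A w00]] := sym_eigen As.
pose w := (Num.sqrt ((w0 *m w0^T) 0 0))^-1 *: w0.
have ww : w *m w^T = 1%:M.
  rewrite /w; have c0 := rv_dot_gt0 w00; set c := (w0 *m _) 0 0 in c0 *.
  have w0E : w0 *m w0^T = c%:M by rewrite [LHS]mx11_scalar.
  rewrite linearZ /= -scalemxAl -scalemxAr scalerA w0E.
  rewrite scale_scalar_mx -invfM -expr2 sqr_sqrtr ?ltW//.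
  by rewrite mulVf// gt_eqF.
have wA : w *m A = a *: w by rewrite /w -scalemxAl w0A !scalerA mulrC.
pose e : 'rV[R]_(1 + m) := row_mx 1%:M 0.
have ee : e *m e^T = 1%:M.
  by rewrite /e tr_row_mx mul_row_col trmx1 mulmx1 mul0mx addr0.
have [H [HT HH eH]] := householder ee ww.
pose B : 'M[R]_(1 + m) := H *m A *m H.
have BT : B^T = B by rewrite /B !trmx_mul HT As mulmxA.
have wH : w *m H = e by rewrite -eH -mulmxA HH mulmx1.
have eB : e *m B = a *: e by rewrite /B !mulmxA eH wA -scalemxAl wH.
pose B' := drsubmx B.
have uB : usubmx B = a *: e.
  rewrite -eB -{2}[B]vsubmxK /e mul_row_col mul1mx mul0mx addr0.
  by [].
have BE : B = block_mx a%:M 0 0 B'.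
  rewrite -[B]submxK.
  have ul : ulsubmx B = a%:M.
    by rewrite /ulsubmx uB /e scale_row_mx row_mxKl scalemx1.
  have ur : ursubmx B = 0.
    by rewrite /ursubmx uB /e scale_row_mx row_mxKr scaler0.
  have dl : dlsubmx B = 0.
    by rewrite -BT -trmx_ursub ur trmx0.
  by rewrite ul ur dl.
have B'T : B'^T = B' by rewrite /B' trmx_drsub BT.
have [[U l] /= [UU BU]] := IH B' B'T.
pose V : 'M[R]_(1 + m) := block_mx 1%:M 0 0 U.
have VV : V^T *m V = 1%:M.
  rewrite /V tr_block_mx mulmx_block !trmx0 !mul0mx !mulmx0 trmx1 mulmx1.
  by rewrite !addr0 add0r UU -scalar_mx_block.
have BV : B *m V = V *m diag_mx (row_mx a%:M l).
  rewrite BE /V diag_mx_row !mulmx_block !mul0mx !mulmx0 !addr0 !add0r BU.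
  rewrite mulmx1 mul1mx; congr block_mx.
  by apply/matrixP=> i j; rewrite !ord1 !mxE.
exists (H *m V, row_mx a%:M l) => /=; split.
  by rewrite trmx_mul HT mulmxA -(mulmxA V^T) HH mulmx1.
have -> : A *m (H *m V) = H *m (B *m V) by rewrite /B !mulmxA HH mul1mx.
by rewrite BV mulmxA.
Qed.

End Spectral.

Lemma eigensolver_exists (R : realType) : exists eig : eig_fun R, eigensolver eig.
Proof.
pose eig : eig_fun R := fun m A =>
  if pselect (A^T = A) is left As then projT1 (cid (real_spectral As))
  else (1%:M, 0).
exists eig => m A As; rewrite /eig; case: pselect => // As'.
by case: cid.
Qed.

(* Main.v *)
Require Import Defs.
From mathcomp Require Import all_boot all_order all_algebra.
From mathcomp Require Import all_classical all_reals all_analysis.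
From mathcomp Require Import ring lra zify.

(* Write q = 2m + 2, let x_i be the rows of X and F(v) = \sum_i <x_i, v> ^ q.
   The candidates are, for every k, the row u = x_k and the top eigenvector w of
   G_u = \sum_i <x_i, u> ^ (2m) x_i x_i^T.  Given v, put c_k = <x_k, v> ^ 2.
   Cauchy-Schwarz for the tensor \sum_k c_k x_k^{(x) 2m} against v^{(x) 2m} and
   against I^{(x) m} bounds F(v) (\sum_k c_k |x_k| ^ (2m)) by
   |v| ^ (2m) d ^ (m/2) \sum_k c_k <v, G_{x_k} v>, so some row u satisfies
   F(v) |u| ^ (2m) <= |v| ^ (2m) d ^ (m/2) <v, G_u v>.  There
   <v, G_u v> <= |v| ^ 2 <w, G_u w>, and weighted AM-GM, applied termwise to
   <w, G_u w>, shows that u or w is a (d ^ (m/2))-approximate maximizer of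
   F(z) / |z| ^ q.  Comparing the l_p and l_2 norms costs the factor
   d ^ gamma_p. *)

Set Implicit Arguments.
Unset Strict Implicit.
Unset Printing Implicit Defensive.

Import Order.TTheory GRing.Theory Num.Theory.

Local Open Scope ring_scope.

(** * Cauchy-Schwarz for tensor powers, and weighted AM-GM *)

Section Inequalities.
Variable R : realFieldType.

(** Lagrange's identity: the double sum of the squares (a_i b_j - a_j b_i) ^ 2 is twice the
    difference of the two sides. *)
Lemma cauchy_schwarz_sum (I : finType) (a b : I -> R) :
  (\sum_i a i * b i) ^+ 2 <= (\sum_i a i ^+ 2) * (\sum_i b i ^+ 2).
Proof.
have : 0 <= \sum_i \sum_j (a i * b j - a j * b i) ^+ 2.
  by apply: sumr_ge0 => i _; apply: sumr_ge0 => j _; exact: sqr_ge0.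
have -> : \sum_i \sum_j (a i * b j - a j * b i) ^+ 2 =
    \sum_i \sum_j (a i ^+ 2 * b j ^+ 2) + \sum_i \sum_j (a j ^+ 2 * b i ^+ 2)
    - 2 * \sum_i \sum_j ((a i * b i) * (a j * b j)).
  rewrite mulr_sumr -big_split -sumrB; apply: eq_bigr => i _ /=.
  rewrite mulr_sumr -big_split -sumrB; apply: eq_bigr => j _ /=; ring.
rewrite [X in _ + X - _]exchange_big /= -!big_distrlr /= -expr2.
lra.
Qed.

(** The power of an inner product is the inner product of tensor powers, whose coordinates are
    indexed by functions from ['I_m] to [J]. *)
Lemma exprn_dot (J : finType) (a b : J -> R) (m : nat) :
  (\sum_j a j * b j) ^+ m =
  \sum_(f : {ffun 'I_m -> J}) (\prod_t a (f t)) * \prod_t b (f t).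
Proof.
rewrite -[LHS](_ : \prod_(t < m) (\sum_j a j * b j) = _); last first.
  by rewrite prodr_const card_ord.
by rewrite bigA_distr_bigA; apply: eq_bigr => f _; rewrite big_split.
Qed.

(* Cauchy-Schwarz between the tensors [\sum_k c k *: A k ^{(x) m}] and
   [b ^{(x) m}]. *)
Lemma tensor_cauchy_schwarz (I J : finType) (c : I -> R) (A : I -> J -> R)
    (b : J -> R) (m : nat) :
  (\sum_k c k * (\sum_j A k j * b j) ^+ m) ^+ 2 <=
  (\sum_k \sum_l c k * c l * (\sum_j A k j * A l j) ^+ m) *
  (\sum_j b j ^+ 2) ^+ m.
Proof.
pose T (f : {ffun 'I_m -> J}) := \sum_k c k * \prod_t A k (f t).
pose B (f : {ffun 'I_m -> J}) := \prod_t b (f t).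
have -> : \sum_k c k * (\sum_j A k j * b j) ^+ m = \sum_f T f * B f.
  under [RHS]eq_bigr do rewrite mulr_suml.
  rewrite [RHS]exchange_big /=; apply: eq_bigr => k _ /=.
  by rewrite exprn_dot mulr_sumr; apply: eq_bigr => f _; rewrite mulrA.
(* The squared norm of the tensor [T] expands into inner products of pure tensors. *)
have -> : \sum_k \sum_l c k * c l * (\sum_j A k j * A l j) ^+ m =
    \sum_f T f ^+ 2.
  under [RHS]eq_bigr do rewrite expr2 big_distrlr /=.
  rewrite [RHS]exchange_big /=; apply: eq_bigr => k _ /=.
  rewrite [RHS]exchange_big /=; apply: eq_bigr => l _ /=.
  rewrite exprn_dot mulr_sumr; apply: eq_bigr => f _; ring.
have -> : (\sum_j b j ^+ 2) ^+ m = \sum_f B f ^+ 2.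
  under eq_bigr do rewrite expr2.
  by rewrite exprn_dot; apply: eq_bigr => f _; rewrite expr2.
exact: cauchy_schwarz_sum.
Qed.

(** Induction: the gap for m + 1 is b times the gap for m plus the nonnegative term (m + 1) a ^ m (a
    - b) ^ 2. *)
Lemma weighted_amgm (m : nat) (a b : R) : 0 <= a -> 0 <= b ->
  m.+1%:R * (a ^+ m * b) <= m%:R * a ^+ m.+1 + b ^+ m.+1.
Proof.
move=> a0 b0; elim: m => [|m IH]; first by rewrite expr0 expr1 !mul1r mul0r add0r.
have am : 0 <= a ^+ m * (m.+1%:R * (a - b) ^+ 2).
  by apply: mulr_ge0; [exact: exprn_ge0 | apply: mulr_ge0 => //; exact: sqr_ge0].
rewrite -subr_ge0; rewrite -subr_ge0 in IH.
have := addr_ge0 am (mulr_ge0 IH b0); congr (_ <= _).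
rewrite -!natr1 !exprS; ring.
Qed.

End Inequalities.

(** * Approximation by the candidates, in the Euclidean norm *)

Section Candidates.
Variables (R : rcfType) (n d : nat) (X : 'M[R]_(n, d)).
Implicit Types u v w : 'cV[R]_d.

Definition sqnorm v : R := \sum_j v j 0 ^+ 2.

(** The function F of the overview, with exponent 2m. Writing even powers as powers of squares makes
    nonnegativity immediate. *)
Definition power_sum m v : R := \sum_i ((X *m v) i 0) ^+ 2 ^+ m.

(** The quadratic form of G_u at v; at v = u it equals [power_sum m.+1 u]. *)
Definition weighted_form m u v : R :=
  \sum_i ((X *m u) i 0) ^+ 2 ^+ m * ((X *m v) i 0) ^+ 2.

Lemma sqnorm_ge0 v : 0 <= sqnorm v.
Proof. by apply: sumr_ge0 => j _; exact: sqr_ge0. Qed.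

Lemma sqnorm_eq0 v : (sqnorm v == 0) = (v == 0).
Proof.
apply/eqP/eqP => [v0|->]; last first.
  by rewrite /sqnorm big1// => j _; rewrite mxE expr0n.
have /psumr_eq0P : forall j : 'I_d, true -> 0 <= v j 0 ^+ 2.
  by move=> j _; exact: sqr_ge0.
move=> /(_ v0) h; apply/colP => j; rewrite mxE; apply/eqP.
by rewrite -sqrf_eq0 h.
Qed.

Lemma sqnorm_gt0 v : (0 < sqnorm v) = (v != 0).
Proof. by rewrite lt_def sqnorm_ge0 sqnorm_eq0 andbT. Qed.

Lemma power_sum_ge0 m v : 0 <= power_sum m v.
Proof. by apply: sumr_ge0 => i _; rewrite exprn_ge0// sqr_ge0. Qed.

Let x k := (row k X)^T.

Let mulX_x i v : (X *m v) i 0 = \sum_j x i j 0 * v j 0.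
Proof. by rewrite mxE; apply: eq_bigr => j _; rewrite !mxE. Qed.

(** Matrices are treated as vectors indexed by pairs: this is the inner product of a a^T and b
    b^T. *)
Lemma outer_dot (a b : 'cV[R]_d) :
  \sum_(s : 'I_d * 'I_d) (a s.1 0 * a s.2 0) * (b s.1 0 * b s.2 0) =
  (\sum_j a j 0 * b j 0) ^+ 2.
Proof.
rewrite expr2 big_distrlr /= pair_big /=; apply: eq_bigr => -[s t] _ /=; ring.
Qed.

(** The inner product of a a^T with the identity matrix is the trace of a a^T. *)
Lemma outer_id (a : 'cV[R]_d) :
  \sum_(s : 'I_d * 'I_d) (a s.1 0 * a s.2 0) * (s.1 == s.2)%:R = sqnorm a.
Proof.
rewrite -(pair_big xpredT xpredT (fun i j => a i 0 * a j 0 * (i == j)%:R)) /=.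
apply: eq_bigr => i _; rewrite (bigD1 i)//= eqxx mulr1 big1 ?addr0 ?expr2//.
by move=> j ji; rewrite eq_sym (negPf ji) mulr0.
Qed.

Lemma sum_id_sqr : \sum_(s : 'I_d * 'I_d) ((s.1 == s.2)%:R : R) ^+ 2 = d%:R.
Proof.
rewrite -(pair_big xpredT xpredT (fun i j : 'I_d => (i == j)%:R ^+ 2 : R)) /=.
rewrite -[RHS](_ : \sum_(i < d) 1 = _); last by rewrite sumr_const card_ord.
apply: eq_bigr => i _; rewrite (bigD1 i)//= eqxx expr1n big1 ?addr0//.
by move=> j ji; rewrite eq_sym (negPf ji) expr0n.
Qed.

(* Averaging over the rows [x k] with weights [<x k, v> ^ 2 |x k| ^ (2 m)]. *)
Lemma good_row m v : power_sum m.+1 v != 0 ->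
  exists k, row k X != 0 /\
    power_sum m.+1 v * sqnorm (x k) ^+ m <=
    Num.sqrt d%:R ^+ m * sqnorm v ^+ m * weighted_form m (x k) v.
Proof.
(* By contradiction: if every nonzero row violates the bound, then so does the weighted sum over the
   rows. *)
move=> T0; have [//|none] := pselect (exists k, row k X != 0 /\
    power_sum m.+1 v * sqnorm (x k) ^+ m <=
    Num.sqrt d%:R ^+ m * sqnorm v ^+ m * weighted_form m (x k) v).
pose c k := ((X *m v) k 0) ^+ 2.
have c_ge0 k : 0 <= c k by exact: sqr_ge0.
have {}T0 : 0 < power_sum m.+1 v by rewrite lt_def T0 power_sum_ge0.
set T := power_sum _ _ in T0 none *; set e := _ ^+ m * _ in none.
have e0 : 0 <= e by rewrite mulr_ge0 ?exprn_ge0 ?sqrtr_ge0 ?sqnorm_ge0.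
(* Up to the factors [T] and [e], these are the sums, with weights [c], of the two sides of the
   desired inequality. *)
pose S := \sum_k c k * sqnorm (x k) ^+ m.
pose Q := \sum_k c k * weighted_form m (x k) v.
pose A k (s : 'I_d * 'I_d) := x k s.1 0 * x k s.2 0.
have QE : Q = \sum_k \sum_l c k * c l * (\sum_s A k s * A l s) ^+ m.
  apply: eq_bigr => k _; rewrite mulr_sumr; apply: eq_bigr => l _.
  rewrite outer_dot mulX_x /c.
  rewrite (eq_bigr (fun j => x k j 0 * x l j 0)) => [|j _]; last by rewrite mulrC.
  ring.
(* Cauchy-Schwarz against the m-th tensor power of v v^T. *)
have TQ : T ^+ 2 <= Q * (sqnorm v ^+ m) ^+ 2.
  have := tensor_cauchy_schwarz c A (fun s => v s.1 0 * v s.2 0) m.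
  rewrite -QE (_ : \sum_k _ = T); last first.
    by apply: eq_bigr => k _; rewrite outer_dot -mulX_x [RHS]exprS.
  congr (_ <= _ * _); under eq_bigr do rewrite expr2.
  rewrite outer_dot exprAC; congr (_ ^+ _ ^+ _).
(* Cauchy-Schwarz against the m-th tensor power of the identity, whose squared norm is d ^ m. *)
have SQ : S ^+ 2 <= Q * d%:R ^+ m.
  have := tensor_cauchy_schwarz c A (fun s => (s.1 == s.2)%:R) m.
  rewrite -QE (_ : \sum_k _ = S) ?sum_id_sqr//.
  by apply: eq_bigr => k _; rewrite outer_id.
have Q0 : 0 <= Q.
  apply: sumr_ge0 => k _; rewrite mulr_ge0//; apply: sumr_ge0 => i _.
  by apply: mulr_ge0; [apply: exprn_ge0|]; exact: sqr_ge0.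
have TS : T * S <= e * Q.
  have S0 : 0 <= S.
    by apply: sumr_ge0 => k _; rewrite mulr_ge0// exprn_ge0// sqnorm_ge0.
  have TS0 : 0 <= T * S by apply: mulr_ge0 => //; exact: ltW.
  (* The product of [TQ] and [SQ] is the square of the claim, since e ^ 2 = d ^ m |v| ^ (4m). *)
  rewrite -ler_sqr ?nnegrE ?(mulr_ge0 e0 Q0)//.
  have := ler_pM (sqr_ge0 _) (sqr_ge0 _) TQ SQ; rewrite -exprMn => /le_trans; apply.
  rewrite le_eqVlt; apply/orP; left; apply/eqP.
  rewrite /e !exprMn -[in RHS]exprM mulnC exprM sqr_sqrtr ?ler0n//; ring.
(* Since [T] is positive, some weight is positive; that row makes the summed inequality strict. *)
have [k ck] : exists k, 0 < c k.
  apply: contrapT => nk; move: T0; rewrite /T /power_sum big1 ?ltxx// => i _.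
  have /negP : ~ 0 < c i by move=> h; apply: nk; exists i.
  by rewrite -leNgt => ci; rewrite (_ : _ ^+ 2 = 0) ?expr0n//; apply/eqP; rewrite eq_le ci c_ge0.
(* A row of nonzero weight is itself nonzero, so [none] applies to it. *)
have lt i : c i != 0 -> e * weighted_form m (x i) v < T * sqnorm (x i) ^+ m.
  move=> ci; rewrite ltNge; apply/negP => h; apply: none; exists i; split => //.
  apply: contra ci => /eqP ri; rewrite /c mulX_x /x ri big1 ?expr0n// => j _.
  by rewrite !mxE mul0r.
suff : e * Q < T * S by rewrite ltNge TS.
rewrite !mulr_sumr (bigD1 k)//= [ltRHS](bigD1 k)//=.
apply: ltr_leD.
  by rewrite mulrCA [ltRHS]mulrCA ltr_pM2l// lt// gt_eqF.
apply: ler_sum => i _; have [->|ci] := eqVneq (c i) 0; first by rewrite !(mul0r,mulr0).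
by rewrite mulrCA [leRHS]mulrCA ler_wpM2l// ltW// lt.
Qed.

(** With a and b the values of F(z) / |z| ^ (2m + 2) at u and w, termwise AM-GM on the normalized
    coordinates bounds (m + 1) <w, G_u w> / (|u| ^ (2m) |w| ^ 2) by m a + b, hence by (m + 1) max(a,
    b). *)
Lemma weighted_form_max m u w : u != 0 -> w != 0 ->
  exists2 z, z \in [:: u; w] &
    weighted_form m u w * sqnorm z ^+ m.+1 <=
    sqnorm u ^+ m * sqnorm w * power_sum m.+1 z.
Proof.
move=> u0 w0; have su : 0 < sqnorm u by rewrite sqnorm_gt0.
have sw : 0 < sqnorm w by rewrite sqnorm_gt0.
pose a := power_sum m.+1 u / sqnorm u ^+ m.+1.
pose b := power_sum m.+1 w / sqnorm w ^+ m.+1.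
have ab : m.+1%:R * (weighted_form m u w / (sqnorm u ^+ m * sqnorm w)) <=
    m%:R * a + b.
  rewrite /a /b /weighted_form /power_sum !mulr_suml !mulr_sumr -big_split.
  apply: ler_sum => i _ /=; set y := _ ^+ 2; set z := (X *m w) _ _ ^+ 2.
  have := @weighted_amgm R m (y / sqnorm u) (z / sqnorm w).
  rewrite !divr_ge0 ?sqr_ge0 ?sqnorm_ge0// => /(_ isT isT).
  by rewrite !expr_div_n mulf_div -mulr_sumr.
have [z zin zM] : exists2 z, z \in [:: u; w] &
    m%:R * a + b <= m.+1%:R * (power_sum m.+1 z / sqnorm z ^+ m.+1).
  have [ab'|ba] := leP a b.
    exists w; rewrite ?inE ?eqxx ?orbT// -/b -natr1 mulrDl mul1r lerD2r.
    exact: ler_wpM2l.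
  exists u; rewrite ?inE ?eqxx// -/a -natr1 mulrDl mul1r lerD2l; exact: ltW.
exists z => //; have z0 : 0 < sqnorm z ^+ m.+1.
  by rewrite exprn_gt0// sqnorm_gt0; move: zin; rewrite !inE => /orP[] /eqP ->.
have := le_trans ab zM; rewrite ler_pM2l ?ltr0n//.
by rewrite ler_pdivrMr ?mulr_gt0 ?exprn_gt0// mulrAC ler_pdivlMr// [leRHS]mulrC.
Qed.

(** The contract between the algorithm and the analysis. For a zero row, u may be any nonzero
    vector; w is a unit maximizer of the quadratic form of G_u. *)
Definition candidate_pair m k u w :=
  [/\ u != 0, row k X != 0 -> u = x k, sqnorm w = 1 &
      forall v, weighted_form m u v <= sqnorm v * weighted_form m u w].

Lemma candidates_approx m (u w : 'I_n -> 'cV[R]_d) v :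
  (0 < n)%N -> (forall k, candidate_pair m k (u k) (w k)) ->
  exists k, exists2 z, z \in [:: u k; w k] &
    power_sum m.+1 v * sqnorm z ^+ m.+1 <=
    Num.sqrt d%:R ^+ m * sqnorm v ^+ m.+1 * power_sum m.+1 z.
Proof.
(* If F(v) = 0 any candidate serves, and n > 0 supplies one. *)
move=> n0 uw; have [T0|] := eqVneq (power_sum m.+1 v) 0.
  exists (Ordinal n0), (u (Ordinal n0)); rewrite ?inE ?eqxx//.
  by rewrite T0 mul0r !mulr_ge0 ?exprn_ge0 ?sqrtr_ge0 ?sqnorm_ge0 ?power_sum_ge0.
move=> /good_row [k [rk Tk]]; exists k; have [u0 /(_ rk) uk w1 wv] := uw k.
have w0 : w k != 0 by rewrite -sqnorm_gt0 w1.
have [z zin zM] := weighted_form_max m u0 w0; exists z => //.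
rewrite w1 mulr1 in zM; rewrite -uk in Tk.
have su : 0 < sqnorm (u k) ^+ m by rewrite exprn_gt0// sqnorm_gt0.
rewrite -(ler_pM2r su) mulrAC; have z0 := exprn_ge0 m.+1 (sqnorm_ge0 z).
apply: le_trans (ler_wpM2r z0 Tk) _.
have e0 : 0 <= Num.sqrt d%:R ^+ m * sqnorm v ^+ m.
  by rewrite mulr_ge0 ?exprn_ge0 ?sqrtr_ge0 ?sqnorm_ge0.
have h : weighted_form m (u k) v * sqnorm z ^+ m.+1 <=
    sqnorm v * (sqnorm (u k) ^+ m * power_sum m.+1 z).
  apply: le_trans (ler_wpM2r z0 (wv v)) _.
  by rewrite -mulrA; apply: ler_wpM2l => //; exact: sqnorm_ge0.
have := ler_wpM2l e0 h; congr (_ <= _); rewrite ?exprS; ring.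
Qed.

End Candidates.

(** * Lp norms *)

Section LpNorms.
Variable R : realType.

(** Machine expressions have no absolute value, so the programs compute |x| ^ r as a real power of a
    square. *)
Lemma sqr_powR (x r : R) : (x ^+ 2) `^ (r / 2) = `|x| `^ r.
Proof.
by rewrite -real_normK ?num_real// -powR_mulrn// -powRrM mulrCA divff ?mulr1.
Qed.

Lemma powR1l (r : R) : 1 `^ r = 1.
Proof. by rewrite powR1. Qed.

(** For r < 1 this is Young's inequality for x ^ r and 1 with the conjugate exponents 1/r and 1/(1 -
    r). *)
Lemma bernoulli_powR (x r : R) : 0 <= x -> 0 < r -> r <= 1 ->
  x `^ r <= r * x + (1 - r).
Proof.
move=> x0 r0; rewrite le_eqVlt => /orP[/eqP ->|r1].
  by rewrite powRr1// mul1r subrr addr0.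
have := @conjugate_powR _ (x `^ r) 1 r^-1 (1 - r)^-1 (powR_ge0 _ _) ler01.
rewrite !invr_gt0 subr_gt0 !invrK => /(_ r0 r1); rewrite addrC subrK => /(_ erefl).
by rewrite mulr1 powR1 mul1r -powRrM divff ?gt_eqF// powRr1// mulrC.
Qed.

Variable k : nat.
Implicit Types v z : 'cV[R]_k.

Lemma lpnorm_ge0 (p : R) v : 0 <= lpnorm p v.
Proof. exact: powR_ge0. Qed.

Lemma sum_powR_ge0 (p : R) v : 0 <= \sum_i `|v i 0| `^ p.
Proof. by apply: sumr_ge0 => i _; exact: powR_ge0. Qed.

Lemma lpnorm_powR (p : R) v : p != 0 -> lpnorm p v `^ p = \sum_i `|v i 0| `^ p.
Proof. by move=> p0; rewrite /lpnorm -powRrM mulVf// powRr1// sum_powR_ge0. Qed.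

Lemma lpnorm_gt0 (p : R) v : 0 < p -> v != 0 -> 0 < lpnorm p v.
Proof.
move=> p0 v0; rewrite lt_def lpnorm_ge0 andbT; apply: contra v0.
move=> /eqP /(congr1 (fun x => x `^ p)); rewrite lpnorm_powR ?gt_eqF//.
rewrite powR0 ?gt_eqF// => /psumr_eq0P h; apply/eqP/colP => i; rewrite mxE.
by apply/eqP; rewrite -normr_eq0; apply/eqP/(@powR_eq0_eq0 _ _ p)/h => // j _; exact: powR_ge0.
Qed.

Lemma lpnorm0 (p : R) : 0 < p -> lpnorm p (0 : 'cV[R]_k) = 0.
Proof.
move=> p0; rewrite /lpnorm big1 ?powR0 ?invr_eq0 ?gt_eqF// => i _.
by rewrite mxE normr0 powR0 ?gt_eqF.
Qed.

Lemma lpnormZ (p c : R) v : 0 < p -> 0 <= c -> lpnorm p (c *: v) = c * lpnorm p v.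
Proof.
move=> p0 c0; rewrite /lpnorm.
under eq_bigr do rewrite mxE normrM powRM// ger0_norm//.
rewrite -mulr_sumr powRM ?powR_ge0 ?sum_powR_ge0// -powRrM divff ?gt_eqF//.
by rewrite powRr1.
Qed.

(** By homogeneity the l_r norm may be taken to be 1; then all entries are at most 1 in absolute
    value, and raising the exponent decreases their powers. *)
Lemma lpnorm_le (r s : R) v : 0 < r -> r <= s -> lpnorm s v <= lpnorm r v.
Proof.
move=> r0 rs; have s0 : 0 < s by exact: lt_le_trans rs.
have [->|v0] := eqVneq v 0; first by rewrite !lpnorm0.
pose t := lpnorm r v; have t0 : 0 < t by exact: lpnorm_gt0.
have t0' : 0 <= t^-1 by rewrite invr_ge0 ltW.
suff : lpnorm s (t^-1 *: v) <= 1.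
  by rewrite (lpnormZ _ s0 t0') (ler_pdivrMl _ _ t0) mulr1.
have E : \sum_i `|(t^-1 *: v) i 0| `^ r = 1.
  rewrite -lpnorm_powR ?gt_eqF// (lpnormZ _ r0 t0') mulVf ?gt_eqF//.
  by rewrite powR1.
rewrite -[leRHS](powR1l s^-1) ge0_ler_powR ?nnegrE ?invr_ge0 ?sum_powR_ge0 ?(ltW s0)//.
rewrite -E; apply: ler_sum => i _; set x := _ i 0.
have x1 : `|x| <= 1.
  have : `|x| `^ r <= 1.
    by rewrite -E (bigD1 i)//= lerDl sumr_ge0// => j _; exact: powR_ge0.
  rewrite -[X in _ <= X](powR1l r).
  by apply: contraTT; rewrite -!ltNge => ?; rewrite gt0_ltr_powR ?nnegrE.
have [->|x0] := eqVneq x 0; first by rewrite normr0 !powR0 ?gt_eqF.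
by rewrite ger_powR// normr_gt0 x0.
Qed.

(** The power mean inequality: after rescaling so that the mean of |w_i| ^ s is 1, Bernoulli with
    exponent r/s applies to each term. *)
Lemma lpnorm_le_dim (r s : R) v : 0 < r -> r <= s ->
  lpnorm r v <= k%:R `^ (r^-1 - s^-1) * lpnorm s v.
Proof.
move=> r0 rs; have s0 : 0 < s by exact: lt_le_trans rs.
have [->|v0] := eqVneq v 0; first by rewrite !lpnorm0// mulr0.
have k0 : (0 : R) < k%:R.
  rewrite ltr0n lt0n; apply/eqP => k0; move: v0; rewrite (_ : v = 0) ?eqxx//.
  by apply/colP => i; have := ltn_ord i; rewrite {2}k0.
(* The power mean of order s of the entries of [v]. *)
pose b := k%:R `^ (- s^-1) * lpnorm s v.
have b0 : 0 < b by apply: mulr_gt0; [exact: powR_gt0 | exact: lpnorm_gt0].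
pose w := b^-1 *: v.
have bE : b `^ s = k%:R^-1 * \sum_i `|v i 0| `^ s.
  rewrite /b powRM ?powR_ge0// lpnorm_powR ?gt_eqF// -powRrM mulNr mulVf ?gt_eqF//.
  by rewrite powR_inv1// ltW.
have vs0 : \sum_i `|v i 0| `^ s != 0.
  by rewrite -lpnorm_powR ?gt_eqF// powR_gt0// lpnorm_gt0.
have wE : \sum_i `|w i 0| `^ s = k%:R.
  under eq_bigr do rewrite mxE normrM powRM//.
  rewrite -mulr_sumr ger0_norm ?invr_ge0 ?(ltW b0)//.
  rewrite -powR_inv1 ?(ltW b0)// powRAC bE.
  rewrite powR_inv1 ?mulr_ge0 ?invr_ge0 ?sum_powR_ge0 ?(ltW k0)//.
  by rewrite invfM invrK mulfVK.
have wr : \sum_i `|w i 0| `^ r <= k%:R.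
  apply: (@le_trans _ _ (\sum_i (r / s * `|w i 0| `^ s + (1 - r / s)))).
    apply: ler_sum => i _.
    have {1}-> : r = s * (r / s) by rewrite mulrC divfK ?gt_eqF.
    rewrite powRrM; apply: bernoulli_powR; rewrite ?powR_ge0 ?divr_gt0//.
    by rewrite ler_pdivrMr// mul1r.
  rewrite big_split /= -mulr_sumr wE sumr_const card_ord -[X in _ + X]mulr_natr.
  by rewrite -mulrDl addrC subrK mul1r.
have vE : v = b *: w by rewrite scalerA divff ?gt_eqF// scale1r.
clearbody w; clearbody b; rewrite vE !lpnormZ ?(ltW b0)//.
rewrite mulrCA (ler_pM2l b0).
have -> : k%:R `^ (r^-1 - s^-1) * lpnorm s w = k%:R `^ r^-1.
  rewrite /lpnorm wE powRD ?(gt_eqF k0) ?implybT// -mulrA -powRD ?(gt_eqF k0) ?implybT//.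
  by rewrite addNr powRr0 mulr1.
by rewrite ge0_ler_powR ?nnegrE ?invr_ge0 ?sum_powR_ge0 ?(ltW r0) ?(ltW k0).
Qed.

Lemma lpnorm2 v : lpnorm 2 v = sqnorm v `^ 2^-1.
Proof.
congr (_ `^ _); apply: eq_bigr => i _.
by rewrite -sqr_powR divff// powRr1 ?sqr_ge0.
Qed.

Lemma lpnorm_even (n m : nat) (X : 'M[R]_(n, k)) v :
  lpnorm (2 * m)%:R (X *m v) = power_sum X m v `^ (2 * m)%:R^-1.
Proof.
congr (_ `^ _); apply: eq_bigr => i _.
by rewrite -sqr_powR natrM mulrAC divff// mul1r powR_mulrn// sqr_ge0.
Qed.

(** Only one of the two norm comparisons costs a power of the dimension: the one for z when p <= 2,
    the one for v when p >= 2. *)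
Lemma gamma_expP (p : R) v z : 1 <= p ->
  lpnorm 2 v * lpnorm p z <=
  k%:R `^ gamma_exp p * (lpnorm p v * lpnorm 2 z).
Proof.
move=> p1; have p0 : 0 < p by exact: lt_le_trans p1.
rewrite /gamma_exp; case: (leP p 2) => p2.
  rewrite [leRHS]mulrCA; apply: ler_pM; try exact: lpnorm_ge0.
    exact: lpnorm_le.
  exact: lpnorm_le_dim.
rewrite [leRHS]mulrA; apply: ler_pM; try exact: lpnorm_ge0.
  by apply: lpnorm_le_dim => //; exact: ltW.
by apply: lpnorm_le => //; exact: ltW.
Qed.

End LpNorms.

(** * From the Euclidean norm to the l_p norm *)

Lemma chain_ratio (R : realFieldType) (A B D1 D2 V2 Vp Z2 Zp : R) :
  0 < Z2 -> 0 <= Zp -> 0 <= D1 * B -> A * Z2 <= D1 * V2 * B ->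
  V2 * Zp <= D2 * (Vp * Z2) -> A * Zp <= D2 * D1 * Vp * B.
Proof.
move=> Z20 Zp0 DB0 h1 h2; rewrite -(ler_pM2r Z20).
rewrite mulrAC; apply: le_trans (ler_wpM2r Zp0 h1) _.
have := ler_wpM2l DB0 h2; congr (_ <= _); ring.
Qed.

Section Approximation.
Variables (R : realType) (n d : nat) (X : 'M[R]_(n, d)).

Lemma candidates_opnorm (p : R) (m : nat) (u w : 'I_n -> 'cV[R]_d) v :
  1 <= p -> (0 < n)%N -> (0 < d)%N ->
  (forall k, candidate_pair X m k (u k) (w k)) ->
  exists k, exists2 z, z \in [:: u k; w k] &
    lpnorm (2 * m.+1)%:R (X *m v) * lpnorm p z <=
    approx_factor p (2 * m.+1) d * lpnorm p v * lpnorm (2 * m.+1)%:R (X *m z).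
Proof.
move=> p1 n0 d0 uw.
have [k [z zin h]] := candidates_approx v n0 uw; exists k, z => //.
set q := (2 * m.+1)%N; have q0 : (0 : R) < q%:R by rewrite ltr0n.
have z0 : z != 0.
  have [u0 _ w1 _] := uw k.
  move: zin; rewrite !inE => /orP[] /eqP -> //.
  by rewrite -sqnorm_gt0 w1.
have d0' : (0 : R) < d%:R by rewrite ltr0n.
have sqE y : (sqnorm y ^+ m.+1) `^ q%:R^-1 = lpnorm 2 y.
  rewrite lpnorm2 -powR_mulrn ?sqnorm_ge0// -powRrM; congr (_ `^ _).
  by rewrite natrM invfM mulrCA divff ?mulr1// pnatr_eq0.
have {h} : lpnorm q%:R (X *m v) * lpnorm 2 z <=
    d%:R `^ (4^-1 - (2 * q%:R)^-1) * lpnorm 2 v * lpnorm q%:R (X *m z).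
  have q0' : 0 <= (q%:R^-1 : R) by rewrite invr_ge0.
  have := ge0_ler_powR q0' _ _ h.
  rewrite !nnegrE !mulr_ge0 ?exprn_ge0 ?sqnorm_ge0 ?power_sum_ge0 ?sqrtr_ge0//.
  move=> /(_ isT isT).
  rewrite !powRM ?mulr_ge0 ?exprn_ge0 ?sqnorm_ge0 ?power_sum_ge0 ?sqrtr_ge0//.
  rewrite !sqE -!lpnorm_even; congr (_ <= _ * _ * _).
  (* The q-th root of d ^ (m/2) is d ^ (m/(2q)), and m/(2q) = 1/4 - 1/(2q) because m = q/2 - 1. *)
  rewrite -powR12_sqrt// -powR_mulrn ?powR_ge0// -!powRrM; congr (_ `^ _).
  rewrite natrM -natr1; field.
  by rewrite lt0r_neq0//; have := ler0n R m; lra.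
have -> : approx_factor p q d =
    d%:R `^ gamma_exp p * d%:R `^ (4^-1 - (2 * q%:R)^-1).
  by rewrite /approx_factor -addrA powRD ?(gt_eqF d0') ?implybT.
have z2 : 0 < lpnorm 2 z by exact: lpnorm_gt0.
move=> h; apply: (chain_ratio z2 _ _ h); last exact: gamma_expP.
- exact: lpnorm_ge0.
- by apply: mulr_ge0; [exact: powR_ge0 | exact: lpnorm_ge0].
Qed.

End Approximation.

(** * Reasoning about programs *)

Arguments CSkip {R}.
Arguments CISet {R}.
Arguments CEig {R}.
Arguments RGet {R}.
Arguments RNat {R}.

Section ProgramLogic.
Variables (R : realType) (eig : eig_fun R).
Implicit Types (s : state R) (c : cmd R).

(** Syntactic over-approximation of the registers that a command may change; together with
    [rwritten] it reduces frame conditions to computation. *)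
Fixpoint iwritten c : seq nat :=
  match c with
  | CSkip | CRSet _ _ _ _ | CEig _ _ _ _ => [::]
  | CSeq c1 c2 | CIfLe _ _ c1 c2 => iwritten c1 ++ iwritten c2
  | CISet x _ => [:: x]
  | CFor x _ c1 => x :: iwritten c1
  end.

Fixpoint rwritten c : seq nat :=
  match c with
  | CSkip | CISet _ _ => [::]
  | CSeq c1 c2 | CIfLe _ _ c1 c2 => rwritten c1 ++ rwritten c2
  | CRSet a _ _ _ => [:: a]
  | CFor _ _ c1 => rwritten c1
  | CEig _ _ b b' => [:: b; b']
  end.

Definition agree (iw rw : seq nat) s s' :=
  (forall x, x \notin iw -> ireg s x = ireg s' x) /\
  (forall a, a \notin rw -> rmem s a = rmem s' a).

Lemma agree_refl iw rw s : agree iw rw s s.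
Proof. by []. Qed.

Lemma agree_trans iw rw s1 s2 s3 :
  agree iw rw s1 s2 -> agree iw rw s2 s3 -> agree iw rw s1 s3.
Proof.
move=> [i1 r1] [i2 r2]; split => x xw; first by rewrite i1 ?i2.
by rewrite r1 ?r2.
Qed.

Lemma agree_sub iw rw iw' rw' s s' :
  {subset iw <= iw'} -> {subset rw <= rw'} ->
  agree iw rw s s' -> agree iw' rw' s s'.
Proof.
move=> si sr [i r]; split => x xw; first by apply: i; apply: contra xw => /si.
by apply: r; apply: contra xw => /sr.
Qed.

Lemma agree_set_ireg iw rw x k s : x \in iw -> agree iw rw (set_ireg x k s) s.
Proof.
by move=> xw; split=> // y yw /=; case: eqP => // yx; rewrite yx xw in yw.
Qed.

Lemma agree_set_array iw rw a A s : a \in rw -> agree iw rw (set_array a A s) s.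
Proof.
by move=> aw; split=> // b bw /=; case: eqP => // ba; rewrite ba aw in bw.
Qed.

Lemma iteri_agree x c s k :
  (forall s', agree (iwritten c) (rwritten c) (exec eig c s') s') ->
  agree (x :: iwritten c) (rwritten c)
    (iteri k (fun l s' => exec eig c (set_ireg x l s')) s) s.
Proof.
move=> ac; elim: k => [|k IH] /=; first exact: agree_refl.
apply: agree_trans IH; apply: agree_trans (agree_set_ireg _ _ _ (mem_head _ _)).
by apply: agree_sub (ac _) => // y yw; rewrite inE yw orbT.
Qed.

Lemma exec_agree c s : agree (iwritten c) (rwritten c) (exec eig c s) s.
Proof.
elim: c s => [|c1 IH1 c2 IH2|x e|a e1 e2 e|e1 e2 c1 IH1 c2 IH2|x e c IH|a e b b'] s.
- exact: agree_refl.
- apply: (@agree_trans _ _ _ (exec eig c1 s)).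
    by apply: agree_sub (IH2 _) => y yw; rewrite mem_cat yw orbT.
  by apply: agree_sub (IH1 _) => y yw; rewrite mem_cat yw.
- by apply: agree_set_ireg; rewrite inE.
- by apply: agree_set_array; rewrite inE.
- rewrite /=; case: ifP => _.
    by apply: agree_sub (IH1 _) => y yw; rewrite mem_cat yw.
  by apply: agree_sub (IH2 _) => y yw; rewrite mem_cat yw orbT.
- exact: iteri_agree.
- rewrite /= /exec_eig; set s1 := set_array b _ s.
  by apply: (@agree_trans _ _ _ s1); apply: agree_set_array;
     rewrite !inE eqxx ?orbT.
Qed.

Lemma exec_ireg c s x : x \notin iwritten c -> ireg (exec eig c s) x = ireg s x.
Proof. exact: (exec_agree c s).1. Qed.

Lemma exec_rmem c s a : a \notin rwritten c -> rmem (exec eig c s) a = rmem s a.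
Proof. exact: (exec_agree c s).2. Qed.

(** The loop invariant rule. The step may also assume that all memory outside the write set is as on
    entry, so invariants need not record it. *)
Lemma exec_for x e c s (I : nat -> state R -> Prop) :
  I 0%N s ->
  (forall k s', (k < ieval s e)%N -> agree (x :: iwritten c) (rwritten c) s' s ->
     I k s' -> I k.+1 (exec eig c (set_ireg x k s'))) ->
  I (ieval s e) (exec eig (CFor x e c) s).
Proof.
move=> I0 IS /=; suff h k : (k <= ieval s e)%N ->
    I k (iteri k (fun l s' => exec eig c (set_ireg x l s')) s) by exact: h.
elim: k => [//|k IH] kN /=; apply: IS => //; last by apply: IH; exact: ltnW.
by apply: iteri_agree => s'; exact: exec_agree.
Qed.

Lemma exec_seq c1 c2 s : exec eig (CSeq c1 c2) s = exec eig c2 (exec eig c1 s).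
Proof. by []. Qed.

Lemma leq_time_seq c1 c2 s : (time eig c1 s <= time eig (CSeq c1 c2) s)%N.
Proof. by rewrite /= -addnS leq_addr. Qed.

(* The loop bounds are all evaluated in [s]: this is sound when the registers
   that occur in them are not written. *)
Fixpoint time_bound s c : nat :=
  match c with
  | CSkip => 1
  | CSeq c1 c2 => (time_bound s c1 + time_bound s c2).+1
  | CISet _ e => (icost e).+1
  | CRSet _ e1 e2 e => (icost e1 + icost e2 + rcost e).+1
  | CIfLe e1 e2 c1 c2 =>
      (rcost e1 + rcost e2 + (time_bound s c1 + time_bound s c2)).+1
  | CFor _ e c1 => (icost e + ieval s e * (time_bound s c1).+1).+1
  | CEig _ e _ _ => (icost e + ieval s e ^ 3).+1
  end%N.

Fixpoint ivars (e : iexp) : seq nat :=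
  match e with
  | IConst _ => [::]
  | IVar x => [:: x]
  | IAdd e1 e2 => ivars e1 ++ ivars e2
  end.

Fixpoint bound_vars c : seq nat :=
  match c with
  | CSkip | CISet _ _ | CRSet _ _ _ _ => [::]
  | CSeq c1 c2 | CIfLe _ _ c1 c2 => bound_vars c1 ++ bound_vars c2
  | CFor _ e c1 => ivars e ++ bound_vars c1
  | CEig _ e _ _ => ivars e
  end.

Lemma eq_ieval (P : pred nat) s s' e :
  (forall x, P x -> ireg s' x = ireg s x) -> all P (ivars e) ->
  ieval s' e = ieval s e.
Proof.
move=> ss'; elim: e => [//|x|e1 IH1 e2 IH2] /=; first by rewrite andbT => /ss'.
by rewrite all_cat => /andP[/IH1 -> /IH2 ->].
Qed.

(** [P] selects protected registers: they contain all loop bounds and are never written, so every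
    bound keeps its value from [s]. A conditional is charged both branches. *)
Lemma time_le_bound (P : pred nat) c s s' :
  (forall x, P x -> ireg s' x = ireg s x) ->
  all P (bound_vars c) -> all (predC P) (iwritten c) ->
  (time eig c s' <= time_bound s c)%N.
Proof.
have frame c1 s1 : all (predC P) (iwritten c1) ->
    (forall x, P x -> ireg s1 x = ireg s x) ->
    forall x, P x -> ireg (exec eig c1 s1) x = ireg s x.
  move=> /allP Pc h x Px; rewrite exec_ireg ?h//.
  by apply/negP => /Pc /=; rewrite Px.
elim: c s' => [|c1 IH1 c2 IH2|x e|a e1 e2 e|e1 e2 c1 IH1 c2 IH2|x e c IH|a e b b']
  s' ss' //=.
- rewrite !all_cat => /andP[b1 b2] /andP[w1 w2].
  by rewrite ltnS leq_add ?IH1 ?IH2//; exact: frame.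
- rewrite !all_cat => /andP[b1 b2] /andP[w1 w2]; rewrite ltnS leq_add2l.
  by case: ifP => _;
    [apply: leq_trans (leq_addr _ _) | apply: leq_trans (leq_addl _ _)]; auto.
- rewrite all_cat => /andP[be bc] /andP[Px wc]; rewrite (eq_ieval ss' be) ltnS leq_add2l.
  rewrite -[X in (_ <= X * _)%N]card_ord -sum_nat_const; apply: leq_sum => k _; rewrite ltnS.
  apply: IH => // y Py; rewrite -ss'//=.
  have /negPf -> : y != x by apply: contra Px => /eqP <-.
  apply: (iteri_agree _ _ _ (exec_agree _)).1; rewrite inE negb_or; apply/andP; split.
    by apply: contra Px => /eqP <-.
  by apply/negP => /(allP wc) /=; rewrite Py.
- by move=> be _; rewrite (eq_ieval ss' be).
Qed.

(** [pre] computes, before each term, what a single expression cannot, such as an inner sum; cell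
    (0, 0) of array [a] accumulates. *)
Definition for_sum (a x : nat) (e : iexp) (pre : cmd R) (body : rexp R) : cmd R :=
  CSeq (CRSet a (IConst 0) (IConst 0) (RConst 0))
    (CFor x e (CSeq pre (CRSet a (IConst 0) (IConst 0)
       (RAdd (RGet a (IConst 0) (IConst 0)) body)))).

Lemma for_sumP a x e pre body s (g : nat -> R) :
  a \notin rwritten pre ->
  (forall k s', (k < ieval s e)%N ->
     agree (x :: iwritten pre) (a :: rwritten pre) s' s ->
     reval (exec eig pre (set_ireg x k s')) body = g k) ->
  rmem (exec eig (for_sum a x e pre body) s) a 0 0 = \sum_(k < ieval s e) g k.
Proof.
move=> apre gE; rewrite /for_sum exec_seq; set s0 := exec eig (CRSet _ _ _ _) s.
have s0E : agree [::] [:: a] s0 s by apply: agree_set_array; rewrite inE.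
have eE : ieval s0 e = ieval s e by apply: (@eq_ieval xpredT) => //; apply/allP.
rewrite -eE.
pose I k s' := rmem s' a 0%N 0%N = \sum_(i < k) g i.
apply: (@exec_for _ _ _ _ I) => [|k s']; rewrite /I ?big_ord0 /=; first by rewrite !eqxx.
rewrite cats0 => kN ag IH; rewrite big_ord_recr /= eqxx /=.
rewrite (exec_rmem _ apre) /= IH gE ?eqE//; first by rewrite -eE.
apply: (@agree_trans _ _ _ s0); last by apply: agree_sub s0E => // y; rewrite !inE => ->.
by apply: agree_sub ag => // y; rewrite mem_cat !inE orbC.
Qed.

Definition for_fill (a : nat) (i : iexp) (x : nat) (e : iexp) (pre : cmd R)
    (body : rexp R) : cmd R :=
  CFor x e (CSeq pre (CRSet a i (IVar x) body)).

Lemma for_fillP a i x e pre body s (g : nat -> R) :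
  a \notin rwritten pre -> x \notin iwritten pre ->
  all (fun y => y \notin x :: iwritten pre) (ivars i) ->
  (forall k s', (k < ieval s e)%N ->
     agree (x :: iwritten pre) (a :: rwritten pre) s' s ->
     reval (exec eig pre (set_ireg x k s')) body = g k) ->
  forall r l, rmem (exec eig (for_fill a i x e pre body) s) a r l =
    if (r == ieval s i) && (l < ieval s e)%N then g l else rmem s a r l.
Proof.
move=> apre xpre ipre gE.
pose I k s' := forall r l, rmem s' a r l =
  if (r == ieval s i) && (l < k)%N then g l else rmem s a r l.
apply: (@exec_for _ _ _ _ I) => [r l|k s']; first by rewrite ltn0 andbF.
rewrite /I /= cats0 => kN ag IH r l /=.
have ag' : agree (x :: iwritten pre) (a :: rwritten pre) s' s.
  by apply: agree_sub ag => // y; rewrite mem_cat !inE orbC.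
rewrite eqxx (exec_rmem _ apre) (exec_ireg _ xpre) /= eqxx gE//.
have -> : ieval (exec eig pre (set_ireg x k s')) i = ieval s i.
  apply: eq_ieval ipre => y; rewrite inE negb_or => /andP[yx ypre].
  rewrite exec_ireg//= (negPf yx); apply: ag'.1.
  by rewrite inE negb_or yx.
rewrite IH ltnS [(l <= k)%N]leq_eqVlt.
by case: (r == _) => //=; case: (eqVneq l k) => [->|_].
Qed.

End ProgramLogic.

(** * The algorithm *)

Section Spectrum.
Variable R : rcfType.

Lemma quad_gram (n d : nat) (X : 'M[R]_(n, d)) (c : 'rV[R]_n) (v : 'cV[R]_d) :
  (v^T *m (X^T *m diag_mx c *m X) *m v) 0 0 = \sum_i c 0 i * ((X *m v) i 0) ^+ 2.
Proof.
rewrite !mulmxA -trmx_mul -2!mulmxA mul_diag_mx mxE; apply: eq_bigr => i _.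
by rewrite !mxE expr2 mulrCA.
Qed.

Lemma sqnormE (d : nat) (v : 'cV[R]_d) : sqnorm v = (v^T *m v) 0 0.
Proof. by rewrite mxE; apply: eq_bigr => j _; rewrite mxE expr2. Qed.

(** In the coordinates y = U^T v the form is the sum of L_j y_j ^ 2, at most L_t |y| ^ 2, and |y| =
    |v| as U is orthogonal. *)
Lemma quad_top_eigenvector (d : nat) (G U : 'M[R]_d) (L : 'rV[R]_d) (t : 'I_d) :
  U^T *m U = 1%:M -> G *m U = U *m diag_mx L -> (forall j, L 0 j <= L 0 t) ->
  sqnorm (col t U) = 1 /\
  forall v : 'cV[R]_d, (v^T *m G *m v) 0 0 <=
    sqnorm v * ((col t U)^T *m G *m col t U) 0 0.
Proof.
move=> UU GU Lt.
have UU' : U *m U^T = 1%:M by exact: mulmx1C.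
have w1 : sqnorm (col t U) = 1.
  have <- : (U^T *m U) t t = 1 by rewrite UU mxE eqxx.
  by rewrite mxE; apply: eq_bigr => j _; rewrite !mxE expr2.
have quadE (v : 'cV[R]_d) :
    (v^T *m G *m v) 0 0 = \sum_j L 0 j * ((U^T *m v) j 0) ^+ 2.
  rewrite -quad_gram trmxK; congr ((_ *m _ *m _) 0 0).
  by rewrite -GU -mulmxA UU' mulmx1.
have wL : ((col t U)^T *m G *m col t U) 0 0 = L 0 t.
  have Uw j : (U^T *m col t U) j 0 = (j == t)%:R.
    have <- : (U^T *m U) j t = (j == t)%:R by rewrite UU mxE.
    by rewrite !mxE; apply: eq_bigr => i _; rewrite !mxE.
  rewrite quadE (bigD1 t)//= big1 => [|j jt]; rewrite Uw ?(negPf jt) ?expr0n ?mulr0//.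
  by rewrite eqxx expr1n mulr1 addr0.
split=> // v; rewrite quadE wL.
have -> : sqnorm v = sqnorm (U^T *m v).
  by rewrite !sqnormE trmx_mul trmxK mulmxA -(mulmxA v^T) UU' mulmx1.
by rewrite mulr_suml; apply: ler_sum => j _; rewrite mulrC ler_wpM2l ?sqr_ge0.
Qed.

End Spectrum.

(** * The programs, their running time and their correctness *)

Section Programs.
Variables (R : realType) (p : R) (m : nat).

(* Registers: 3 is the index of the current vector, 4 runs over rows, 5 and 6
   over columns, 7 holds an argmax.  Arrays: 4 the squared norm of the current
   row, 6 the weights <x_i, u> ^ (2m), 8 the matrix G_u, 9 and 10 its
   eigenvectors and eigenvalues, 11 and 12 the sums of powers in the norms of v
   and X v, 14 their ratio, 15 the norm of the best vector so far; 5, 7 and 13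
   are scratch.  Vector k of the list is the row x_k, vector n + k is the
   eigenvector computed from it. *)
Definition dot_prog (a i k : nat) : cmd R :=
  for_sum a 5 (IVar 1) CSkip
    (RMul (RGet 0 (IVar i) (IVar 5)) (RGet 1 (IVar k) (IVar 5))).

Definition row_prog : cmd R :=
  for_fill 1 (IVar 3) 5 (IVar 1) CSkip (RGet 0 (IVar 3) (IVar 5)).

Definition row_norm_prog : cmd R :=
  for_sum 4 5 (IVar 1) CSkip
    (RMul (RGet 0 (IVar 3) (IVar 5)) (RGet 0 (IVar 3) (IVar 5))).

(* A zero row is replaced by a unit vector, as the list may not contain 0. *)
Definition fix_row_prog : cmd R :=
  CIfLe (RGet 4 (IConst 0) (IConst 0)) (RConst 0)
    (CRSet 1 (IVar 3) (IConst 0) (RConst 1)) CSkip.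

Definition weights_prog : cmd R :=
  for_fill 6 (IConst 0) 4 (IVar 0) (dot_prog 5 4 3)
    (RPow (RMul (RGet 5 (IConst 0) (IConst 0)) (RGet 5 (IConst 0) (IConst 0)))
       m%:R).

Definition gram_prog : cmd R :=
  CFor 5 (IVar 1)
    (for_fill 8 (IVar 5) 6 (IVar 1)
       (for_sum 7 4 (IVar 0) CSkip
          (RMul (RGet 6 (IConst 0) (IVar 4))
             (RMul (RGet 0 (IVar 4) (IVar 5)) (RGet 0 (IVar 4) (IVar 6)))))
       (RGet 7 (IConst 0) (IConst 0))).

Definition eig_prog : cmd R := CEig 8 (IVar 1) 9 10.

Definition top_prog : cmd R :=
  CSeq (CISet 7 (IConst 0))
    (CFor 5 (IVar 1)
       (CIfLe (RGet 10 (IConst 0) (IVar 7)) (RGet 10 (IConst 0) (IVar 5))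
          (CISet 7 (IVar 5)) CSkip)).

Definition eigvec_prog : cmd R :=
  for_fill 1 (IAdd (IVar 0) (IVar 3)) 5 (IVar 1) CSkip
    (RGet 9 (IVar 5) (IVar 7)).

Definition candidate_prog : cmd R :=
  CSeq row_prog (CSeq row_norm_prog (CSeq fix_row_prog (CSeq weights_prog
    (CSeq gram_prog (CSeq eig_prog (CSeq top_prog eigvec_prog)))))).

Definition list_prog : cmd R :=
  CSeq (CISet 2 (IAdd (IVar 0) (IVar 0))) (CFor 3 (IVar 0) candidate_prog).

Definition den_prog : cmd R :=
  for_sum 11 5 (IVar 1) CSkip
    (RPow (RMul (RGet 1 (IVar 3) (IVar 5)) (RGet 1 (IVar 3) (IVar 5))) (p / 2)).

Definition num_prog : cmd R :=
  for_sum 12 4 (IVar 0) (dot_prog 13 4 3)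
    (RPow (RMul (RGet 13 (IConst 0) (IConst 0)) (RGet 13 (IConst 0) (IConst 0)))
       m.+1%:R).

Definition norm_exp : rexp R := RPow (RGet 11 (IConst 0) (IConst 0)) p^-1.

Definition ratio_prog : cmd R :=
  CRSet 14 (IConst 0) (IConst 0)
    (RDiv (RPow (RGet 12 (IConst 0) (IConst 0)) (2 * m.+1)%:R^-1) norm_exp).

(** The comparison is not strict: ratios being nonnegative, the first vector always replaces the
    initial 0, so register 7 and array 15 are set even if all ratios vanish. *)
Definition max_prog : cmd R :=
  CIfLe (RGet 2 (IConst 0) (IConst 0)) (RGet 14 (IConst 0) (IConst 0))
    (CSeq (CRSet 2 (IConst 0) (IConst 0) (RGet 14 (IConst 0) (IConst 0)))
       (CSeq (CISet 7 (IVar 3)) (CRSet 15 (IConst 0) (IConst 0) norm_exp)))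
    CSkip.

Definition best_prog : cmd R :=
  CFor 3 (IAdd (IVar 0) (IVar 0))
    (CSeq den_prog (CSeq num_prog (CSeq ratio_prog max_prog))).

Definition normalize_prog : cmd R :=
  for_fill 3 (IConst 0) 5 (IVar 1) CSkip
    (RDiv (RGet 1 (IVar 7) (IVar 5)) (RGet 15 (IConst 0) (IConst 0))).

Definition scale_prog : cmd R :=
  CRSet 2 (IConst 0) (IConst 0)
    (RMul (RPow (RNat (IVar 1)) (gamma_exp p + 4^-1 - (2 * (2 * m.+1)%:R)^-1))
       (RGet 2 (IConst 0) (IConst 0))).

(** One program serves both consequences: it leaves the certified bound in array 2 and the
    normalized best vector in array 3. *)
Definition best_vec_prog : cmd R :=
  CSeq (CRSet 2 (IConst 0) (IConst 0) (RConst 0))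
    (CSeq best_prog (CSeq normalize_prog scale_prog)).

(** All loop bounds come from registers 0 and 1. The dominant costs, over n candidates, are the Gram
    matrices, n d ^ 2 each, and the eigendecompositions, d ^ 3 each. *)
Lemma list_best_time (eig : eig_fun R) (n d : nat) (X : 'M[R]_(n, d)) :
  (0 < n)%N -> (0 < d)%N ->
  (time eig (CSeq list_prog best_vec_prog) (init_state X) <=
   500 * (n ^ 2 * d ^ 2 + n * d ^ 3))%N.
Proof.
move=> n0 d0.
apply: leq_trans (@time_le_bound _ _ (fun x => x < 2)%N _ (init_state X) _ _ _ _) _ => //.
cbn -[addn muln expn leq].
(* Each lower-order monomial is dominated by n ^ 2 d ^ 2 or n d ^ 3, as n and d are positive. *)
have [n2 d2] : (n <= n * n /\ d <= d * d)%N by rewrite !leq_pmull.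
have d3 : (d * d <= d * d * d)%N by rewrite leq_pmulr.
have nd : (n * d <= n * (d * d * d))%N by rewrite leq_mul2l orbC (leq_trans d2).
have ndd : (n * (d * d) <= n * (d * d * d))%N by rewrite leq_mul2l orbC d3.
have n1 : (n <= n * d)%N by rewrite leq_pmulr.
have d1 : (d <= n * d)%N by rewrite leq_pmull.
have nnd : (n * n * d <= n * n * (d * d))%N by rewrite leq_mul2l orbC d2.
have nn : (n * n <= n * n * d)%N by rewrite leq_pmulr.
lia.
Qed.

Variables (eig : eig_fun R) (n d : nat) (X : 'M[R]_(n, d)).
Hypotheses (eigP : eigensolver eig) (n_gt0 : (0 < n)%N) (d_gt0 : (0 < d)%N).
Implicit Types s : state R.

Lemma dot_progP a i k s : a != 0%N -> a != 1%N -> i != 5 -> k != 5 ->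
  rmem (exec eig (dot_prog a i k) s) a 0 0 =
  \sum_(j < ireg s 1) rmem s 0 (ireg s i) j * rmem s 1 (ireg s k) j.
Proof.
move=> a0 a1 i5 k5.
apply: (for_sumP _ 
  (g := fun j => rmem s 0 (ireg s i) j * rmem s 1 (ireg s k) j)) => //.
move=> j s' _ [ai ar] /=.
have -> : rmem s' 0 = rmem s 0 by apply: ar; rewrite /= inE eq_sym.
have -> : rmem s' 1 = rmem s 1 by apply: ar; rewrite /= inE eq_sym.
by rewrite (negPf i5) (negPf k5) !ai ?inE.
Qed.


Definition mem_row s r : 'cV[R]_d := \col_j rmem s 1 r j.

Definition input s :=
  [/\ ireg s 0 = n, ireg s 1 = d &
      forall (i : 'I_n) (j : 'I_d), rmem s 0 i j = X i j].

Lemma input_agree iw rw s s' : 0%N \notin iw -> 1%N \notin iw -> 0%N \notin rw ->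
  agree iw rw s' s -> input s -> input s'.
Proof.
move=> i0 i1 r0 [ai ar] [sn sd sX]; split; rewrite ?ai//.
by move=> i j; rewrite ar.
Qed.

Lemma input_exec c s : 0%N \notin iwritten c -> 1%N \notin iwritten c ->
  0%N \notin rwritten c -> input s -> input (exec eig c s).
Proof. by move=> i0 i1 r0; apply: input_agree (exec_agree _ _ _). Qed.

Lemma dot_mulmx s (i : 'I_n) k : input s ->
  \sum_(j < ireg s 1) rmem s 0 i j * rmem s 1 k j = (X *m mem_row s k) i 0.
Proof.
move=> [_ -> sX]; rewrite mxE; apply: eq_bigr => j _.
by rewrite !mxE sX.
Qed.

Lemma row_candidateP s (k : 'I_n) : input s -> ireg s 3 = k ->
  let s' := exec eig fix_row_prog (exec eig row_norm_prog (exec eig row_prog s)) in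
  [/\ mem_row s' k != 0, row k X != 0 -> mem_row s' k = (row k X)^T &
      forall r : nat, r != k -> rmem s' 1 r = rmem s 1 r].
Proof.
move=> sI sk; set s1 := exec eig row_prog s; set s2 := exec eig row_norm_prog s1.
have [sn sd sX] := sI.
have s1E r l : rmem s1 1 r l =
    if (r == k) && (l < d)%N then rmem s 0 k l else rmem s 1 r l.
  rewrite -sk -sd; apply: (for_fillP (g := fun l => rmem s 0 (ireg s 3) l)) => //.
  by move=> j s' _ [ai ar] /=; rewrite ai ?ar.
have s1I : input s1 by exact: input_exec.
have s1k : ireg s1 3 = k by rewrite exec_ireg.
have [_ s1d s1X] := s1I.
have s2E : rmem s2 4 0 0 = sqnorm (row k X)^T.
  rewrite /s2 /row_norm_prog.
  rewrite (for_sumP (g := fun j => rmem s1 0 k j * rmem s1 0 k j)) //=; last first.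
    by move=> j s' _ [ai ar] /=; rewrite ai// ar// s1k.
  by rewrite s1d; apply: eq_bigr => j _; rewrite s1X !mxE expr2.
have s2k : ireg s2 3 = k by rewrite exec_ireg.
have s2r : rmem s2 1 = rmem s1 1 by rewrite exec_rmem.
rewrite /fix_row_prog /= s2E s2k; case: ifPn => [le0|].
  have rk0 : row k X = 0.
    apply/trmx_inj/eqP; rewrite trmx0 -sqnorm_eq0.
    by rewrite eq_le le0 sqnorm_ge0.
  split; last 2 first.
  - by rewrite rk0 eqxx.
  - move=> r rk; apply: funext => l /=. rewrite (negPf rk) /= s2r s1E.
    by rewrite (negPf rk).
  (* The replacement vector has a 1 in coordinate 0, which exists because d > 0. *)
  apply/eqP => /colP /(_ (Ordinal d_gt0)); rewrite !mxE /= !eqxx /= => /eqP.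
  by rewrite oner_eq0.
rewrite -ltNge sqnorm_gt0 => rk0.
have uE : mem_row s2 k = (row k X)^T.
  by apply/colP => j; rewrite !mxE s2r s1E eqxx ltn_ord sX.
split; rewrite ?uE// => r rk; apply: funext => l.
by rewrite s2r s1E (negPf rk).
Qed.

Lemma weights_progP s k (i : 'I_n) : input s -> ireg s 3 = k ->
  rmem (exec eig weights_prog s) 6 0 i = ((X *m mem_row s k) i 0) ^+ 2 ^+ m.
Proof.
move=> sI sk; have [sn sd sX] := sI.
rewrite /weights_prog.
rewrite (for_fillP (g := fun i => (\sum_(j < ireg s 1) rmem s 0 i j * rmem s 1 k j)
  ^+ 2 ^+ m)) //; first by rewrite /= sn ltn_ord dot_mulmx.
move=> j s' _ [ai ar]; cbn [reval ieval]; rewrite dot_progP//= !ai ?ar// sk.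
by rewrite -expr2 powR_mulrn ?sqr_ge0.
Qed.

Lemma gram_progP s (j l : 'I_d) : input s ->
  rmem (exec eig gram_prog s) 8 j l =
  \sum_(i < n) rmem s 6 0 i * (X i j * X i l).
Proof.
move=> sI; have [sn sd sX] := sI.
pose g j l := \sum_(i < n) rmem s 6 0 i * (rmem s 0 i j * rmem s 0 i l).
have -> : \sum_(i < n) rmem s 6 0 i * (X i j * X i l) = g j l.
  by apply: eq_bigr => i _; rewrite !sX.
pose I (k : nat) s' :=
  forall j' l', (j' < k)%N -> (l' < d)%N -> rmem s' 8 j' l' = g j' l'.
have : I (ieval s (IVar 1)) (exec eig gram_prog s).
  apply: exec_for => // k s' kN [ai ar] IH j' l' j'k l'd.
  rewrite (for_fillP (g := g k)) //; last first.
    move=> l1 s1 _ [ai1 ar1]; cbn [reval ieval].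
    rewrite (for_sumP (g := fun i => rmem s 6 0 i * (rmem s 0 i k * rmem s 0 i l1))) //=.
      by rewrite ai1//= ai// sn.
    move=> i s2 _ [ai2 ar2] /=.
    by rewrite !ar2//= !ai2//= !ar1//= !ar// ai1.
  rewrite /= ai// sd l'd andbT; case: eqVneq => [->//|nk].
  by apply: IH => //; move: j'k; rewrite ltnS leq_eqVlt (negPf nk).
by rewrite /= sd; apply.
Qed.

Lemma eig_progP s (j l : 'I_d) : input s ->
  let G := \matrix_(j < d, l < d) rmem s 8 j l in
  rmem (exec eig eig_prog s) 9 j l = (eig G).1 j l /\
  rmem (exec eig eig_prog s) 10 0 j = (eig G).2 0 j.
Proof.
move=> [_ sd _] /=; rewrite /exec_eig sd /= /put_mx.
rewrite !valK (insubT (fun i => i < 1)%N (isT : (0 < 1)%N)) /=.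
by split=> //; congr (_ _ _); apply: val_inj.
Qed.

Lemma top_progP s : input s ->
  exists t : 'I_d, ireg (exec eig top_prog s) 7 = t /\
    forall j : 'I_d, rmem s 10 0 j <= rmem s 10 0 t.
Proof.
move=> sI; have [sn sd sX] := sI.
pose I (k : nat) s' := (ireg s' 7 < d)%N /\
  forall j, (j < k)%N -> rmem s 10 0 j <= rmem s 10 0 (ireg s' 7).
have : I d (exec eig top_prog s).
  rewrite /top_prog exec_seq; set s0 := exec eig _ s.
  have -> : d = ieval s0 (IVar 1) by rewrite -sd.
  apply: exec_for => [//|k s' kN [ai ar] [td tM]].
  have kd : (k < d)%N by move: kN; rewrite /= sd.
  rewrite /I /= ar//; case: leP => [le|/ltW le] /=; split=> // j.
    rewrite ltnS leq_eqVlt => /orP[/eqP -> //|jk].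
    exact: le_trans (tM _ jk) le.
  by rewrite ltnS leq_eqVlt => /orP[/eqP -> //|/tM].
move=> [td tM]; exists (Ordinal td); split => // j.
exact: tM.
Qed.

(** The second conjunct is for the loop over k: iteration k touches only vectors k and n + k, so
    earlier pairs survive. *)
Lemma candidate_progP s (k : 'I_n) : input s -> ireg s 3 = k ->
  let s' := exec eig candidate_prog s in
  candidate_pair X m k (mem_row s' k) (mem_row s' (n + k)) /\
  forall r : nat, r != k -> r != (n + k)%N -> rmem s' 1 r = rmem s 1 r.
Proof.
move=> sI sk; rewrite /candidate_prog !exec_seq.
have [u0 uk rk] := row_candidateP sI sk.
set s3 := exec eig fix_row_prog _ in u0 uk rk *.
set s4 := exec eig weights_prog s3; set s5 := exec eig gram_prog s4.
set s6 := exec eig eig_prog s5; set s7 := exec eig top_prog s6.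
set s8 := exec eig eigvec_prog s7.
have s3I : input s3 by do 3 apply: input_exec => //.
have s4I : input s4 by exact: input_exec.
have s5I : input s5 by exact: input_exec.
have s6I : input s6 by exact: input_exec.
have s3k : ireg s3 3 = k by rewrite !exec_ireg.
set u := mem_row s3 k in u0 uk.
pose c : 'rV[R]_n := \row_i ((X *m u) i 0) ^+ 2 ^+ m.
pose G := \matrix_(j < d, l < d) rmem s5 8 j l.
have GE : G = X^T *m diag_mx c *m X.
  apply/matrixP => j l; rewrite [LHS]mxE gram_progP// mxE; apply: eq_bigr => i _.
  by rewrite (weights_progP _ s3I s3k) [LHS]mulrCA [LHS]mulrA mul_mx_diag !mxE.
(* Symmetry is the condition under which the eigensolver gives its guarantee. *)
have GT : G^T = G by rewrite GE !trmx_mul trmxK tr_diag_mx mulmxA.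
have [UU GU] := eigP GT.
set U := (eig G).1 in UU GU; set L := (eig G).2 in GU.
have [t [s7t tmax]] := top_progP s6I; rewrite -/s7 in s7t.
have Lt j : L 0 j <= L 0 t.
  by rewrite -(eig_progP j j s5I).2 -(eig_progP t t s5I).2; exact: tmax.
have [w1 wmax] := quad_top_eigenvector UU GU Lt.
have [_ s7d _] : input s7 by exact: input_exec.
have s8E r l : rmem s8 1 r l =
    if (r == (n + k)%N) && (l < d)%N then rmem s7 9 l t else rmem s3 1 r l.
  have <- : rmem s7 1 = rmem s3 1.
    by do 4 rewrite [LHS]exec_rmem//.
  rewrite /s8 /eigvec_prog (for_fillP (g := fun l => rmem s7 9 l t)) //=.
    by rewrite s7d !exec_ireg// sk; have [-> _ _] := sI.
  by move=> j s' _ [ai ar]; rewrite ai// ar// s7t.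
have uE : mem_row s8 k = u.
  apply/colP => j; rewrite !mxE s8E ifF//.
  by have kn := ltn_ord k; apply/negP => /andP[/eqP E _]; clear -kn E; lia.
have wE : mem_row s8 (n + k) = col t U.
  apply/colP => j; rewrite !mxE s8E eqxx ltn_ord /= exec_rmem//.
  by rewrite (eig_progP j t s5I).1.
split=> [|r rk1 rk2].
  rewrite uE wE; split => // v.
  have quadE z : weighted_form X m u z = (z^T *m G *m z) 0 0.
    by rewrite GE quad_gram; apply: eq_bigr => i _; rewrite [c 0 i]mxE.
  by rewrite !quadE.
by apply: funext => l; rewrite s8E (negPf rk2) rk.
Qed.

Lemma input_init : input (init_state X).
Proof. by split=> // i j; rewrite /= /put_mx !valK. Qed.

Lemma list_progP s : input s ->
  let s' := exec eig list_prog s in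
  [/\ input s', ireg s' 2 = (n + n)%N &
      forall k : 'I_n, candidate_pair X m k (mem_row s' k) (mem_row s' (n + k))].
Proof.
move=> sI; rewrite /list_prog exec_seq; set s0 := exec eig (CISet _ _) s.
have s0I : input s0 by [].
have [s0n _ _] := s0I; have [sn _ _] := sI.
pose I k s' := forall k' : 'I_n, (k' < k)%N ->
  candidate_pair X m k' (mem_row s' k') (mem_row s' (n + k')).
have In : I (ieval s0 (IVar 0)) (exec eig (CFor 3 (IVar 0) candidate_prog) s0).
  apply: exec_for => // k s' /=; rewrite sn => kn ag IH k'; rewrite ltnS => k'k.
  have s'I : input (set_ireg 3 k s').
    by apply: (input_agree _ _ _ ag s0I).
  have [cand keep] := @candidate_progP _ (Ordinal kn) s'I erefl.
  have [E|k'k1] := eqVneq (k' : nat) k.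
    by have -> : k' = Ordinal kn by exact: val_inj.
  have rowE r : r != k -> r != (n + k)%N ->
      mem_row (exec eig candidate_prog (set_ireg 3 k s')) r = mem_row s' r.
    by move=> rk rnk; apply/colP => j; rewrite !mxE keep.
  have kn' := ltn_ord k'.
  rewrite !rowE; [|by clear -k'k k'k1 kn kn'; lia..].
  by apply: IH; rewrite ltn_neqAle k'k1.
split; [exact: input_exec | by rewrite exec_ireg//= sn |].
by move=> k; apply: In; rewrite /= sn.
Qed.

Let q := (2 * m.+1)%N.

Definition row_ratio s k : R :=
  lpnorm q%:R (X *m mem_row s k) / lpnorm p (mem_row s k).

Lemma ratio_progP s k : input s -> ireg s 3 = k ->
  let s' := exec eig ratio_prog (exec eig num_prog (exec eig den_prog s)) in
  rmem s' 14 0 0 = row_ratio s k /\ reval s' norm_exp = lpnorm p (mem_row s k).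
Proof.
move=> sI sk; have [sn sd sX] := sI.
set s1 := exec eig den_prog s; set s2 := exec eig num_prog s1.
have s1E : rmem s1 11 0 0 = \sum_j `|mem_row s k j 0| `^ p.
  rewrite /s1 /den_prog.
  rewrite (for_sumP (g := fun j => `|rmem s 1 k j| `^ p)) //=; last first.
    by move=> j s' _ [ai ar] /=; rewrite ai// ar// sk -expr2 sqr_powR.
  by rewrite sd; apply: eq_bigr => j _; rewrite mxE.
have s1I : input s1 by exact: input_exec.
have s1k : ireg s1 3 = k by rewrite exec_ireg.
have rowE : mem_row s1 k = mem_row s k.
  by apply/colP => j; rewrite !mxE exec_rmem.
have s2E : rmem s2 12 0 0 = power_sum X m.+1 (mem_row s k).
  rewrite /s2 /num_prog.
  rewrite (for_sumP (g := fun i => (\sum_(j < ireg s1 1) rmem s1 0 i j * rmem s1 1 k j)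
    ^+ 2 ^+ m.+1)) //; last first.
    move=> i s' _ [ai ar]; cbn [reval ieval]; rewrite dot_progP//= !ai ?ar// s1k.
    by rewrite -expr2 powR_mulrn ?sqr_ge0.
  have [s1n _ _] := s1I; rewrite [ieval _ _]/= s1n; apply: eq_bigr => i _.
  by rewrite dot_mulmx// rowE.
have s2n : rmem s2 11 0 0 = rmem s1 11 0 0 by rewrite exec_rmem.
by rewrite /= s2n s1E s2E /row_ratio lpnorm_even.
Qed.

Lemma best_vec_progP s : input s ->
  let s' := exec eig best_vec_prog s in
  exists2 t, (t < n + n)%N &
    [/\ forall i, (i < n + n)%N -> row_ratio s i <= row_ratio s t,
        out_num s' = approx_factor p q d * row_ratio s t &
        out_vec d s' = (lpnorm p (mem_row s t))^-1 *: mem_row s t].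
Proof.
move=> sI; have [sn sd _] := sI.
rewrite /best_vec_prog !exec_seq; set s0 := exec eig _ s.
have s0I : input s0 by exact: input_exec.
(* Before the first iteration there is no best vector; afterwards t is an argmax among the first
   k. *)
pose I k s' := if k is 0%N then rmem s' 2 0 0 = 0 else
  exists2 t, (t < k)%N &
    [/\ forall i, (i < k)%N -> row_ratio s i <= row_ratio s t,
        ireg s' 7 = t, rmem s' 2 0 0 = row_ratio s t &
        rmem s' 15 0 0 = lpnorm p (mem_row s t)].
have : I (ieval s0 (IAdd (IVar 0) (IVar 0))) (exec eig best_prog s0).
  apply: exec_for => [//|k s' _ ag IH].
  rewrite !exec_seq; set s1 := set_ireg 3 k s'.
  have s1I : input s1 by apply: (input_agree _ _ _ ag s0I).
  have rowE : mem_row s1 k = mem_row s k.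
    by apply/colP => j; rewrite !mxE /= ag.2.
  have [] := @ratio_progP s1 k s1I erefl; set s2 := exec eig ratio_prog _.
  rewrite /row_ratio rowE -/(row_ratio s k) => s2r s2n.
  have s2b : rmem s2 2 0 0 = rmem s' 2 0 0 by rewrite /s2 !exec_rmem.
  have s27 : ireg s2 7 = ireg s' 7 by rewrite /s2 !exec_ireg.
  have s2d : rmem s2 15 0 0 = rmem s' 15 0 0 by rewrite /s2 !exec_rmem.
  have s2k : ireg s2 3 = k by rewrite /s2 !exec_ireg //= eqxx.
  rewrite -/s2; clearbody s2; rewrite /I /= s2b s2r; case: leP => [le|lt].
    exists k; first exact: ltnSn.
    split; [move=> i | exact: s2k | by [] | exact: s2n].
    rewrite ltnS leq_eqVlt => /orP[/eqP ->|ik]; first exact: lexx.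
    case: k IH le ik {s1 s1I rowE s2 s2r s2n s2b s27 s2d s2k ag} => [_ _ i0|k].
      by exfalso; rewrite ltn0 in i0.
    by move=> [t _ [tM _ -> _]] le /tM h; exact: le_trans h le.
  case: k IH lt {s1 s1I rowE s2r s2n s2k ag} s2b s27 s2d => [->|k].
    by rewrite ltNge divr_ge0 ?lpnorm_ge0.
  move=> [t tk [tM t7 tb t15]] lt s2b s27 s2d; exists t; first exact: ltnW.
  split; [move=> i | by rewrite s27 | by rewrite s2b | by rewrite s2d].
  rewrite ltnS leq_eqVlt => /orP[/eqP ->|/tM]; last exact.
  by rewrite -tb; exact: ltW.
rewrite [ieval _ _]/= sn; set s1 := exec eig best_prog s0.
(* Since n > 0, the invariant is in its successor branch. *)
have -> : (n + n)%N = (n + n).-1.+1 by rewrite prednK// addn_gt0 n_gt0.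
move=> [t tn [tM t7 s1b t15]].
have s1I : input s1 by exact: input_exec.
have [_ s1d _] := s1I.
set s2 := exec eig normalize_prog s1.
have s2d : ireg s2 1 = d by rewrite exec_ireg.
have s2b : rmem s2 2 0 0 = rmem s1 2 0 0 by rewrite exec_rmem.
exists t => //; split=> //; first by rewrite /out_num /scale_prog /= s2d s2b s1b.
apply/colP => j; rewrite !mxE exec_rmem// /s2 /normalize_prog.
rewrite (for_fillP (g := fun l => rmem s 1 t l / lpnorm p (mem_row s t))) //=.
  by rewrite s1d ltn_ord mulrC.
move=> l s' _ [ai ar] /=; rewrite !ai// !ar// t7 t15; congr (_ / _).
by rewrite /s1 !exec_rmem.
Qed.

End Programs.

(** * The operator norm from a list of approximate maximizers *)

Section Opnorm.
Variables (R : realType) (n d : nat) (X : 'M[R]_(n, d)) (p : R) (q : nat) (D : R).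
Variable L : seq 'cV[R]_d.
Implicit Types v z : 'cV[R]_d.
Hypotheses (p_gt0 : 0 < p) (q_gt0 : (0 < q)%N) (D_ge0 : 0 <= D).
Hypothesis L_neq0 : {in L, forall z, z != 0 :> 'cV[R]_d}.
Hypothesis L_approx : forall v, exists2 z, z \in L &
  lpnorm q%:R (X *m v) * lpnorm p z <=
  D * lpnorm p v * lpnorm q%:R (X *m z).

Lemma max_ratio_ub v : lpnorm p v = 1 -> lpnorm q%:R (X *m v) <= D * max_ratio p q X L.
Proof.
move=> v1; have [z zL h] := L_approx v; rewrite v1 mulr1 in h.
have z0 : 0 < lpnorm p z by exact: lpnorm_gt0 (L_neq0 zL).
have : lpnorm q%:R (X *m v) <= D * (lpnorm q%:R (X *m z) / lpnorm p z).
  by rewrite mulrA (ler_pdivlMr _ _ z0).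
move=> /le_trans; apply; apply: ler_wpM2l => //.
exact: (le_bigmax_seq _ z xpredT (fun z => lpnorm q%:R (X *m z) / lpnorm p z)).
Qed.

Lemma lpnorm_normalize z : z != 0 -> lpnorm p ((lpnorm p z)^-1 *: z) = 1.
Proof.
move=> z0; have pz := lpnorm_gt0 p_gt0 z0.
by rewrite lpnormZ ?invr_ge0 ?lpnorm_ge0// mulVf// gt_eqF.
Qed.

Lemma lpnorm_mul_normalize z : z != 0 ->
  lpnorm q%:R (X *m ((lpnorm p z)^-1 *: z)) = lpnorm q%:R (X *m z) / lpnorm p z.
Proof.
move=> z0; rewrite -scalemxAr lpnormZ ?ltr0n// ?invr_ge0 ?lpnorm_ge0//.
exact: mulrC.
Qed.

Lemma ratio_le_opnorm z : z != 0 ->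
  lpnorm q%:R (X *m z) / lpnorm p z <= opnorm p q%:R X.
Proof.
(* A member of a set lies below its [sup] once the set is bounded above; the list supplies the
   bound. *)
move=> z0; rewrite -lpnorm_mul_normalize//; apply: ub_le_sup.
  by exists (D * max_ratio p q X L) => _ [v /= v1 <-]; exact: max_ratio_ub.
by exists ((lpnorm p z)^-1 *: z) => //=; exact: lpnorm_normalize.
Qed.

Lemma opnorm_le_max_ratio z : z != 0 -> opnorm p q%:R X <= D * max_ratio p q X L.
Proof.
(* The normalized [z] shows that the unit sphere is nonempty. *)
move=> z0; apply: ge_sup; last by move=> _ [v /= v1 <-]; exact: max_ratio_ub.
by eexists; exists ((lpnorm p z)^-1 *: z) => //=; exact: lpnorm_normalize.
Qed.

Lemma max_ratio_le_opnorm z : z != 0 -> max_ratio p q X L <= opnorm p q%:R X.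
Proof.
move=> z0; rewrite /max_ratio big_seq; apply: bigmax_le => [|i iL].
  (* The default value 0 of the maximum lies below any ratio, hence below the norm. *)
  apply: le_trans (ratio_le_opnorm z0).
  by apply: divr_ge0; exact: lpnorm_ge0.
exact: ratio_le_opnorm (L_neq0 iL).
Qed.

End Opnorm.

Theorem theorem3p6 (R : realType) :
  exists C : nat,
  forall (p : R) (q : nat), ~~ odd q -> 1 <= p -> p <= q%:R ->
  exists cList cCert cVec : cmd R,
  forall eig : eig_fun R, eigensolver eig ->
  forall (n d : nat) (X : 'M[R]_(n, d)), (0 < n)%N -> (0 < d)%N ->
  let run c := exec eig c (init_state X) in
  let cost c := time eig c (init_state X) in
  let bound := (C * (n ^ 2 * d ^ 2 + n * d ^ 3))%N in
  let D := approx_factor p q d in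
  let N := opnorm p q%:R X in
  [/\ (cost cList <= bound)%N /\
      (let L := out_list d (run cList) in
       [/\ (0 < size L <= C * (n + d))%N,
           {in L, forall v, v <> 0},
           N <= D * max_ratio p q X L
         & D * max_ratio p q X L <= D * N]),
      (cost (CSeq cList cCert) <= bound)%N /\
      (let alg := out_num (run (CSeq cList cCert)) in
       N <= alg /\ forall alpha : R, 0 < alpha -> N <= alpha -> alg <= alpha * D)
    & (cost (CSeq cList cVec) <= bound)%N /\
      (let v := out_vec d (run (CSeq cList cVec)) in
       lpnorm p v = 1 /\ N / D <= lpnorm q%:R (X *m v))].
Proof.
(* The constant comes from the running time; it also covers the list length 2n. *)
exists 500%N => p q oq p1 pq.
have q0 : (0 < q)%N by rewrite -(ltr0n R); exact: lt_le_trans (lt_le_trans ltr01 p1) pq.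
have [m qE] : exists m, q = (2 * m.+1)%N.
  by exists q./2.-1; rewrite prednK ?mul2n ?even_halfK//; case: q q0 oq {pq} => [|[]].
have p0 : 0 < p by exact: lt_le_trans p1.
exists (list_prog R m), (best_vec_prog p m), (best_vec_prog p m).
move=> eig eigP n d X n0 d0 run cost bound D N.
have tle : (cost (CSeq (list_prog R m) (best_vec_prog p m)) <= bound)%N.
  exact: list_best_time.
have [sI s2 cand] := list_progP m eigP d0 (input_init X).
set s := exec eig (list_prog R m) _ in sI s2 cand.
pose L := [seq mem_row d s k | k <- iota 0 (n + n)].
have LE : out_list d (run (list_prog R m)) = L by rewrite /out_list s2.
have kL k : (k < n + n)%N -> mem_row d s k \in L.
  by move=> kn; apply: map_f; rewrite mem_iota.
have LP z : z \in L -> exists k, (k < n + n)%N /\ z = mem_row d s k.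
  by move=> /mapP[k]; rewrite mem_iota add0n => /andP[_ kn] ->; exists k.
have L0 : {in L, forall z, z != 0}.
  move=> z /LP [k [kn ->]]; have [kn'|nk] := ltnP k n.
    by have [] := cand (Ordinal kn').
  have kn' : (k - n < n)%N by rewrite ltn_subLR.
  have [_ _ + _] := cand (Ordinal kn'); rewrite /= subnKC// -sqnorm_gt0 => ->.
  exact: ltr01.
have Lapprox v : exists2 z, z \in L &
    lpnorm q%:R (X *m v) * lpnorm p z <= D * lpnorm p v * lpnorm q%:R (X *m z).
  have [k [z zin h]] := candidates_opnorm v p1 n0 d0 cand.
  exists z; last by rewrite /D qE.
  by move: zin; rewrite !inE => /orP[] /eqP ->; apply: kL;
    [rewrite ltn_addr | rewrite ltn_add2l].
have D0 : 0 < D by rewrite powR_gt0// ltr0n.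
have z0 : mem_row d s 0 != 0 by apply/L0/kL; rewrite addn_gt0 n0.
have hi := opnorm_le_max_ratio p0 (ltW D0) L0 Lapprox z0.
have lo := max_ratio_le_opnorm p0 q0 (ltW D0) L0 Lapprox z0.
have [t tn [tM numE vecE]] := best_vec_progP p m eig n0 sI.
have tL : mem_row d s t != 0 by apply/L0/kL.
have ratioE k : row_ratio p m X s k =
    lpnorm q%:R (X *m mem_row d s k) / lpnorm p (mem_row d s k).
  by rewrite qE.
(* The program maximizes over indices, [max_ratio] over the list; the values agree. *)
have maxE : max_ratio p q X L = row_ratio p m X s t.
  apply/eqP; rewrite eq_le; apply/andP; split.
    rewrite /max_ratio big_seq; apply: bigmax_le => [|z /LP [k [kn ->]]].
      by rewrite ratioE; apply: divr_ge0; exact: lpnorm_ge0.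
    by rewrite -ratioE; exact: tM.
  rewrite ratioE; apply: (le_bigmax_seq _ _ xpredT
    (fun z => lpnorm q%:R (X *m z) / lpnorm p z)) => //.
  exact: kL.
split; first split.
- exact: leq_trans (leq_time_seq eig (list_prog R m) (best_vec_prog p m) _) tle.
- rewrite LE; split.
  + rewrite size_map size_iota addn_gt0 n0 /=; lia.
  + by move=> z /L0 /eqP.
  + exact: hi.
  + by apply: ler_wpM2l lo; exact: ltW.
- split=> //; rewrite /run exec_seq numE -qE -/D -maxE; split; first exact: hi.
  by move=> a a0 Na; rewrite mulrC; apply: ler_wpM2r (le_trans lo Na); exact: ltW.
- split=> //; rewrite /run exec_seq vecE; split; first exact: lpnorm_normalize.
  rewrite lpnorm_mul_normalize// -ratioE -maxE (ler_pdivrMr _ _ D0) mulrC; exact: hi.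
Qed.
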